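(* Let $k\ge 2$ be a constant integer and let $f(n)=o(\log\log n)$ be an arbitrary function with $f(n)\to\infty$. Let $G(n)$ be a random $k$-tree on $n+k$ vertices, and suppose that initially one vertex of $G(n)$ knows the rumor. Then, with probability $1-o(1)$ as $n\to\infty$, the Push-Pull protocol needs at least $n^{(k-1)/(k^2+k-1)}f(n)^{-2}$ rounds to inform all vertices of $G(n)$.
   Context: Random $k$-tree process: $G(0)$ is a clique on $k$ vertices; for $t=1,2,\dots,n$, $G(t)$ is obtained from $G(t-1)$ by choosing a $k$-clique of $G(t-1)$ uniformly at random, creating a new vertex, and joining it to all $k$ vertices of the chosen clique. $G(n)$ is called a random $k$-tree on $n+k$ vertices. Push-Pull protocol on a graph: in synchronous rounds, every informed vertex contacts a uniformly random neighbor and sends it the rumor, and every uninformed vertex contacts a uniformly random neighbor and receives the rumor if that neighbor knows it; all random choices are independent, and a vertex informed in a round cannot forward the rumor in that same round. *)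

(* Defs.v *)
From HB Require Import structures.
From mathcomp Require Import all_boot all_order all_algebra.
From mathcomp Require Import all_classical all_reals all_analysis.
Unset Printing Implicit Defensive.
Import Order.TTheory GRing.Theory Num.Theory.
Local Open Scope ring_scope.

(* A simple graph on the vertex set 'I_N is a set of ordered pairs (its
   edge relation, kept symmetric and irreflexive by construction). *)
Definition graph (N : nat) := {set ('I_N * 'I_N)}.

Definition adj (N : nat) (E : graph N) (u v : 'I_N) : bool := (u, v) \in E.

(* Vertices are numbered 0..n+k-1.  G(0) is the clique on vertices 0..k-1;
   step number i (i = 0..n-1, producing G(i+1)) adds vertex k+i. *)
Definition init_clique (N k : nat) : graph N :=
  [set p : 'I_N * 'I_N | [&& (p.1 < k)%N, (p.2 < k)%N & p.1 != p.2]].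

Definition kcliques (N k i : nat) (E : graph N) : {set {set 'I_N}} :=
  [set A : {set 'I_N} | [&& #|A| == k,
     [forall u in A, (u < k + i)%N] &
     [forall u in A, forall w in A, (u != w) ==> adj N E u w]]].

Definition add_vertex (N : nat) (E : graph N) (v : nat) (A : {set 'I_N}) : graph N :=
  E :|: [set p : 'I_N * 'I_N |
           ((val p.1 == v) && (p.2 \in A)) || ((val p.2 == v) && (p.1 \in A))].

(* kt_ev F m i E : expectation of F (G(i+m)) when the process is currently at
   G(i) = E and m more steps are performed (each step chooses a k-clique of the
   current graph uniformly at random). *)
Fixpoint kt_ev (R : realType) (N k : nat) (F : graph N -> R) (m i : nat)
    (E : graph N) : R :=
  match m with
  | 0 => F E
  | m'.+1 =>
      let C := kcliques N k i E in
      (#|C|%:R)^-1 * \sum_(A in C) kt_ev R N k F m' i.+1 (add_vertex N E (k + i) A)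
  end.

Definition random_ktree_ev (R : realType) (k n : nat) (F : graph (n + k) -> R) : R :=
  kt_ev R (n + k) k F n 0 (init_clique (n + k) k).

Definition nbrs (N : nat) (E : graph N) (v : 'I_N) : {set 'I_N} :=
  [set w | adj N E v w].

(* In a round every vertex v contacts c v, a uniformly random neighbour, all
   independently.  Probability of a contact function c (a vertex without
   neighbours contacts nobody, encoded as c v = v). *)
Definition contact_weight (R : realType) (N : nat) (E : graph N)
    (c : {ffun 'I_N -> 'I_N}) : R :=
  \prod_(v : 'I_N)
    (if #|nbrs N E v| == 0%N then ((c v == v)%:R : R)
     else ((c v \in nbrs N E v)%:R : R) / (#|nbrs N E v|%:R)).

(* One round: informed vertices push to their contact, uninformed vertices
   pull from their contact; only vertices informed before the round forward. *)
Definition pp_step (N : nat) (c : {ffun 'I_N -> 'I_N}) (I : {set 'I_N}) :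
    {set 'I_N} :=
  I :|: [set v | c v \in I] :|: (c @: I).

Fixpoint pp_ev (R : realType) (N : nat) (E : graph N) (F : {set 'I_N} -> R)
    (r : nat) (I : {set 'I_N}) : R :=
  match r with
  | 0 => F I
  | r'.+1 => \sum_(c : {ffun 'I_N -> 'I_N})
               contact_weight R N E c * pp_ev R N E F r' (pp_step N c I)
  end.

Definition pp_done_prob (R : realType) (N : nat) (E : graph N) (s : 'I_N)
    (r : nat) : R :=
  pp_ev R N E (fun I => ((I == [set: 'I_N]) %:R : R)) r [set s].

Definition ktree_pp_done_prob (R : realType) (k n : nat)
    (s : graph (n + k) -> 'I_(n + k)) (r : nat) : R :=
  random_ktree_ev R k n (fun E => pp_done_prob R (n + k) E (s E) r) .

(* Main.v *)
(* The rumor crosses a given edge [xy] in one round with probability at most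
   [1 / deg x + 1 / deg y], so an edge cut delays it by the inverse of the sum of
   these numbers over the cut.

   Such cuts are grown from the [k]-cliques [C] present at time [m] (the roots): [k]
   new vertices are added one by one, each attached to its predecessors and to what
   is left of [C], and one more is attached to the clique that they form. This
   leaves [k^2 - 1] cliques straddling the two sides; as long as none of them is
   chosen, both sides grow separately and the cut keeps its at most [k^2] edges.

   The structure is completed between times [m] and [2m] with probability bounded
   below, and then survives up to time [n] with probability of order
   [(m/n)^((k^2-1)/k)]. For [m] a large multiple of [n^((k^2-1)/(k^2+k-1))], the
   mean number of surviving roots is large, and it is concentrated because a chosen
   clique affects at most one root. On the other hand the numbers of cliques lying
   on the own side of an end vertex of the cut are Polya urns, so that their inverses
   have mean of order [(m/n)^((k-1)/k) = n^(-(k-1)/(k^2+k-1))]; averaging over the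
   surviving roots yields one root whose cut is crossed this rarely. *)
Require Import Defs.
From HB Require Import structures.
From mathcomp Require Import all_boot all_order all_algebra.
From mathcomp Require Import zify ring lra.
From mathcomp Require Import reals.
Import Order.TTheory GRing.Theory Num.Theory.

(** * Rumors crossing an edge cut *)

Section PushPull.
Local Open Scope ring_scope.
Variables (R : realType) (N : nat) (E : graph N).
Hypothesis symE : forall x y, ((x, y) \in E) = ((y, x) \in E).
Local Notation V := 'I_N.
Implicit Types (c : {ffun V -> V}) (I U : {set V}).

Definition contact_pr (v w : V) : R :=
  if #|nbrs N E v| == 0%N then (w == v)%:R else (w \in nbrs N E v)%:R / #|nbrs N E v|%:R.

Lemma contact_pr_ge0 v w : 0 <= contact_pr v w.
Proof. by rewrite /contact_pr; case: ifP => _; rewrite ?divr_ge0 ?ler0n. Qed.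

Lemma sum_contact_pr v : \sum_w contact_pr v w = 1.
Proof.
rewrite /contact_pr; case: (eqVneq #|nbrs N E v| 0%N) => [_|d0].
  by rewrite (bigD1 v) //= eqxx big1 ?addr0 // => w /negbTE ->.
by rewrite -mulr_suml -natr_sum -big_mkcond /= sum1_card mulfV // pnatr_eq0.
Qed.

Lemma contact_weightE c : contact_weight R N E c = \prod_v contact_pr v (c v).
Proof. by []. Qed.

Lemma contact_weight_ge0 c : 0 <= contact_weight R N E c.
Proof. by rewrite contact_weightE prodr_ge0 // => v _; exact: contact_pr_ge0. Qed.

Lemma sum_contact_weight : \sum_c contact_weight R N E c = 1.
Proof.
under eq_bigr => c _ do rewrite contact_weightE.
by rewrite -bigA_distr_bigA big1 // => v _; exact: sum_contact_pr.
Qed.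

Lemma contact_marginal v w :
  \sum_c contact_weight R N E c * (c v == w)%:R = contact_pr v w.
Proof.
(* The indicator is absorbed into the factor of [v], so that the sum over contact functions
   factorizes over the vertices. *)
pose F u x : R := contact_pr u x * (if u == v then (x == w)%:R else 1).
transitivity (\sum_(c : {ffun V -> V}) \prod_u F u (c u)).
  apply: eq_bigr => c _; rewrite /F big_split /= -contact_weightE; congr (_ * _).
  by rewrite (bigD1 v) //= eqxx big1 ?mulr1 // => u /negbTE ->.
rewrite -bigA_distr_bigA (bigD1 v) //= [X in _ * X]big1 ?mulr1.
  rewrite /F eqxx (bigD1 w) //= eqxx mulr1 big1 ?addr0 // => x /negbTE ->.
  by rewrite mulr0.
move=> u /negbTE uv; rewrite -[RHS](sum_contact_pr u); apply: eq_bigr => x _.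
by rewrite /F uv mulr1.
Qed.

Lemma contact_pr_adj v w : (v, w) \in E -> contact_pr v w = #|nbrs N E v|%:R^-1.
Proof.
move=> vw; have wv : w \in nbrs N E v by rewrite inE.
have d0 : #|nbrs N E v| == 0%N = false.
  by rewrite cards_eq0; apply/negbTE/set0Pn; exists w.
by rewrite /contact_pr d0 wv mul1r.
Qed.

Lemma contact_support c v : contact_weight R N E c != 0 -> c v = v \/ (v, c v) \in E.
Proof.
rewrite contact_weightE => /prodf_neq0 /(_ v isT); rewrite /contact_pr.
case: ifP => _; first by case: (c v =P v) => [|_]; [left|rewrite /= eqxx].
case: (boolP (c v \in nbrs N E v)) => [|_]; last by rewrite mul0r eqxx.
by rewrite inE; right.
Qed.

Lemma pp_ev_le1 F r I : (forall J, F J <= 1) -> pp_ev R N E F r I <= 1.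
Proof.
move=> F1; elim: r I => [|r IH] I //=; rewrite -sum_contact_weight.
by apply: ler_sum => c _; rewrite ler_piMr // contact_weight_ge0.
Qed.

Variable U : {set V}.

Definition cut : {set V * V} := [set p in E | (p.1 \in U) && (p.2 \notin U)].
Definition cut_rate : R :=
  \sum_(p in cut) (#|nbrs N E p.1|%:R^-1 + #|nbrs N E p.2|%:R^-1).

Definition crossing c := [exists v, (v \in U) != (c v \in U)].

(** Union bound over the cut: a crossing contact runs along a cut edge, and either end of it picks
    the other with probability the inverse of its own degree. *)
Lemma crossing_prob : \sum_c contact_weight R N E c * (crossing c)%:R <= cut_rate.
Proof.
apply: (@le_trans _ _ (\sum_c contact_weight R N E c *
    \sum_(p in cut) ((c p.1 == p.2)%:R + (c p.2 == p.1)%:R))).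
  apply: ler_sum => c _.
  have [w0|w0] := eqVneq (contact_weight R N E c) 0; first by rewrite w0 !mul0r.
  rewrite ler_wpM2l ?contact_weight_ge0 //.
  have t0 (p : V * V) : 0 <= (c p.1 == p.2)%:R + (c p.2 == p.1)%:R :> R by rewrite addr_ge0.
  have [/existsP[v vU]|_] := boolP (crossing c); last by apply: sumr_ge0.
  have vcv : (v, c v) \in E.
    by case: (contact_support c v w0) => // e; rewrite e eqxx in vU.
  (* The pair of [v] and [c v] is oriented with its end in [U] first; the self-contact of an
     isolated vertex does not cross. *)
  have [p pc p1] : exists2 p, p \in cut & 1 <= (c p.1 == p.2)%:R + (c p.2 == p.1)%:R :> R.
    case: (boolP (v \in U)) vU => vU; case: (boolP (c v \in U)) => // cU _.
      by exists (v, c v); rewrite ?inE /= ?vcv ?vU //= eqxx lerDl.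
    have cvv : (c v, v) \in E by rewrite symE.
    by exists (c v, v); rewrite ?inE /= ?cvv ?cU ?vU //= eqxx lerDr.
  by rewrite (bigD1 p) //= (le_trans p1) // lerDl sumr_ge0.
under eq_bigr => c _ do rewrite mulr_sumr.
rewrite exchange_big /=; apply: ler_sum => -[x y]; rewrite inE => /andP[/= xy _].
have yx : (y, x) \in E by rewrite symE.
under eq_bigr => c _ do rewrite mulrDr.
by rewrite big_split /= !contact_marginal !contact_pr_adj.
Qed.

Lemma cut_rate_ge0 : 0 <= cut_rate.
Proof. by apply: sumr_ge0 => p _; rewrite addr_ge0 ?invr_ge0 ?ler0n. Qed.

Lemma pp_step_side c I : ~~ crossing c ->
  (I \subset U -> pp_step N c I \subset U) /\ (I \subset ~: U -> pp_step N c I \subset ~: U).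
Proof.
rewrite negb_exists => /forallP ncl.
have cU v : (c v \in U) = (v \in U) by apply/esym/eqP; have := ncl v; rewrite negbK.
split=> /subsetP IU; apply/subsetP => v; rewrite !inE => /orP[/orP[/IU|/IU]|/imsetP[u /IU + ->]];
  by rewrite ?inE ?cU.
Qed.

(** Union bound over the rounds: as long as no contact crosses the cut, the informed set stays on
    its side and misses the other, nonempty one. *)
Lemma pp_cut_side r I : U != set0 -> ~: U != set0 ->
  (I \subset U) || (I \subset ~: U) ->
  pp_ev R N E (fun J => (J == [set: V])%:R) r I <= r%:R * cut_rate.
Proof.
move=> U0 CU0; elim: r I => [|r IH] I sI.
  rewrite mul0r /=; case: eqP => // eI; move: sI; rewrite eI !subTset => /orP[]/eqP e.
    by rewrite e setCT eqxx in CU0.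
  by rewrite -[U]setCK e setCT eqxx in U0.
rewrite /=; apply: (@le_trans _ _ (\sum_c contact_weight R N E c * ((crossing c)%:R + r%:R * cut_rate))).
  apply: ler_sum => c _; rewrite ler_wpM2l ?contact_weight_ge0 //.
  have [cc|cc] := boolP (crossing c).
    rewrite (le_trans (pp_ev_le1 _ _ _ _)) ?lerDl ?mulr_ge0 ?cut_rate_ge0 //.
    by move=> J; rewrite lern1 leq_b1.
  rewrite add0r IH //; have [s1 s2] := pp_step_side c I cc.
  by case/orP: sI => [/s1 ->|/s2 ->]; rewrite ?orbT.
under eq_bigr => c _ do rewrite mulrDr.
rewrite big_split /= -mulr_suml sum_contact_weight mul1r -natr1 mulrDl mul1r addrC lerD2l.
exact: crossing_prob.
Qed.

Lemma pp_done_cut s r : U != set0 -> ~: U != set0 ->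
  pp_done_prob R N E s r <= r%:R * cut_rate.
Proof.
move=> U0 CU0; apply: pp_cut_side => //.
by rewrite !sub1set inE orbN.
Qed.

Lemma pp_done_ge0 s r : 0 <= pp_done_prob R N E s r.
Proof.
rewrite /pp_done_prob; elim: r [set s] => [|r IH] I //=.
by apply: sumr_ge0 => c _; rewrite mulr_ge0 ?contact_weight_ge0.
Qed.

Lemma pp_done_le1 s r : pp_done_prob R N E s r <= 1.
Proof. by apply: pp_ev_le1 => J; rewrite lern1 leq_b1. Qed.

End PushPull.

(** * Cuts grown from a clique *)

Section KTreeHistory.
Variables (N n k : nat) (x0 : 'I_N).
Hypothesis nkN : n + k <= N.
Hypothesis k_ge2 : 1 < k.
Local Notation V := 'I_N.
Implicit Types (A B C U W : {set V}) (h : seq {set V}) (v x y : V).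

(* A history lists the chosen cliques, newest first; [newv t] is the vertex added
   after [t] choices. *)
Definition newv t : V := insubd x0 (k + t).

Fixpoint graph_of h : graph N :=
  if h is A :: h' then add_vertex N (graph_of h') (k + size h') A
  else init_clique N k.

(** Locked against simplification; [cliques_ofE] unfolds it on demand. *)
Definition cliques_of h : {set {set V}} := locked (kcliques N k (size h) (graph_of h)).

Lemma cliques_ofE h : cliques_of h = kcliques N k (size h) (graph_of h).
Proof. by rewrite /cliques_of -lock. Qed.

Fixpoint valid h : bool :=
  if h is A :: h' then [&& A \in cliques_of h', size h' < n & valid h'] else true.

(** * Clique and degree counts in a growing k-tree *)

Lemma val_newv t : t < n -> newv t = k + t :> nat.
Proof. by move=> tn; rewrite /newv insubdK // unfold_in; lia. Qed.

Lemma clique_card h A : A \in cliques_of h -> #|A| = k.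
Proof. by rewrite cliques_ofE inE => /and3P[/eqP]. Qed.

Lemma clique_lt h A x : A \in cliques_of h -> x \in A -> x < k + size h.
Proof. by rewrite cliques_ofE inE => /and3P[_ /forall_inP P _] /P. Qed.

Lemma clique_neq0 h A : A \in cliques_of h -> A != set0.
Proof. by move=> /clique_card cA; rewrite -card_gt0 cA; lia. Qed.

Lemma graph_of_lt h p : valid h -> p \in graph_of h -> (p.1 < k + size h) && (p.2 < k + size h).
Proof.
elim: h p => [|A h IH] p /=.
  by move=> _; rewrite inE addn0 => /and3P[-> -> _].
move=> /and3P[Acl hn /IH {}IH]; rewrite !inE => /orP[/IH|]; first by move=> /= /andP[? ?]; lia.
by case/orP=> /andP[/eqP/= -> /(clique_lt _ _ _ Acl)] ?; rewrite addnS leqnn; lia.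
Qed.

Lemma newv_notin h A : size h < n -> A \in cliques_of h -> newv (size h) \notin A.
Proof.
move=> hn Acl; apply/negP => /(clique_lt _ _ _ Acl).
by rewrite val_newv //; lia.
Qed.

Lemma graph_of_cons h A x y : size h < n ->
  ((x, y) \in graph_of (A :: h)) =
  [|| (x, y) \in graph_of h, (x == newv (size h)) && (y \in A)
    | (y == newv (size h)) && (x \in A)].
Proof. by move=> hn; rewrite /= !inE -(val_newv _ hn) !(inj_eq val_inj). Qed.

Arguments graph_of : simpl never.

Lemma newv_gr h x : valid h -> size h < n ->
  ((newv (size h), x) \in graph_of h = false) * ((x, newv (size h)) \in graph_of h = false).
Proof.
by move=> vh hn; split; apply/negP => /(graph_of_lt _ _ vh) /=; rewrite val_newv //; lia.
Qed.

(** The neighbours of the new vertex are exactly the vertices of [A]. A new clique therefore takes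
    [k - 1] of them and is determined by the vertex [a] that it leaves out. *)
Lemma clique_cons h A : valid (A :: h) ->
  cliques_of (A :: h) = cliques_of h :|: [set newv (size h) |: (A :\ a) | a in A].
Proof.
move=> /= /and3P[Acl hn vh]; set v := newv (size h).
have vA : v \notin A by apply: newv_notin.
apply/setP => B; apply/idP/setUP.
  rewrite cliques_ofE inE => /and3P[/eqP cB /forall_inP ltB /forall_inP adB].
  have [vB|vB] := boolP (v \in B); [right | left].
    have sBA : B :\ v \subset A.
      apply/subsetP => y /setD1P[yv yB].
      have /forall_inP/(_ _ yB) := adB _ vB.
      rewrite eq_sym yv /= /adj graph_of_cons // -/v (newv_gr h y vh hn).1 eqxx /= (negbTE yv) /=.
      by rewrite orbF.
    have cB1 : #|B :\ v| = k.-1 by move: cB; rewrite (cardsD1 v) vB add1n => <-.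
    have : 0 < #|A :\: (B :\ v)|.
      by rewrite cardsD (setIidPr sBA) cB1 (clique_card _ _ Acl); lia.
    case/card_gt0P => a /setDP[aA aB].
    apply/imsetP; exists a => //.
    rewrite -[LHS](setD1K vB); congr (_ |: _).
    apply/eqP; rewrite eqEcard cB1.
    have := clique_card _ _ Acl; rewrite (cardsD1 a) aA add1n => cA.
    rewrite (_ : #|A :\ a| <= k.-1) ?andbT; last by lia.
    apply/subsetP => y yB; rewrite !inE (subsetP sBA) // andbT.
    by apply: contraNneq aB => <-.
  rewrite cliques_ofE inE cB eqxx /=; apply/andP; split; apply/forall_inP => y yB.
    have := ltB _ yB; rewrite /=.
    have : y != v :> nat by rewrite (inj_eq val_inj); apply: contraNneq vB => <-.
    by rewrite val_newv //; lia.
  have yv : y != v by apply: contraNneq vB => <-.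
  apply/forall_inP => z zB; have zv : z != v by apply: contraNneq vB => <-.
  have /forall_inP/(_ _ zB) := adB _ yB.
  by rewrite /adj graph_of_cons // -/v (negbTE yv) (negbTE zv) !orbF.
case=> [Bcl|/imsetP[a aA ->]]; rewrite cliques_ofE inE.
  rewrite (clique_card _ _ Bcl) eqxx /=; apply/andP; split; apply/forall_inP => y yB.
    by have := clique_lt _ _ _ Bcl yB; lia.
  move: Bcl; rewrite cliques_ofE inE => /and3P[_ _ /forall_inP /(_ _ yB) /forall_inP adB].
  apply/forall_inP => z zB; apply/implyP => yz; rewrite /adj graph_of_cons //.
  by have := implyP (adB _ zB) yz; rewrite /adj => ->.
have vAa : v \notin A :\ a by rewrite inE negb_and vA orbT.
have cA := clique_card _ _ Acl; rewrite (cardsD1 a) aA add1n in cA.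
rewrite cardsU1 vAa add1n cA eqxx /=; apply/andP; split; apply/forall_inP => y.
  case/setU1P => [->|/setD1P[_ /(clique_lt _ _ _ Acl)]]; first by rewrite val_newv //; lia.
  by lia.
move=> yB; apply/forall_inP => z zB; apply/implyP => yz; rewrite /adj graph_of_cons //.
case/setU1P: yB yz => [->|/setD1P[_ yA]]; case/setU1P: zB => [->|/setD1P[_ zA]].
- by rewrite eqxx.
- by rewrite -/v eqxx zA /= orbT.
- by rewrite -/v eqxx yA /= !orbT.
move: Acl; rewrite cliques_ofE inE => /and3P[_ _ /forall_inP /(_ _ yA) /forall_inP /(_ _ zA)].
by move=> /implyP P /P; rewrite /adj => ->.
Qed.

(** New cliques contain the new vertex, so none of them is old, and they are indexed injectively by
    the omitted vertex. Most counts below reduce to this one. *)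
Lemma card_cliques_of_cons (P : pred {set V}) h A : valid (A :: h) ->
  #|[set B in cliques_of (A :: h) | P B]| =
  #|[set B in cliques_of h | P B]| + #|[set a in A | P (newv (size h) |: (A :\ a))]|.
Proof.
move=> vAh; rewrite clique_cons //.
move: vAh => /= /and3P[Acl hn vh]; set v := newv (size h).
have vA : v \notin A by apply: newv_notin.
have inj : {in A &, injective (fun a => v |: (A :\ a))}.
  move=> a b aA bA /= e.
  have : a \notin v |: (A :\ b).
    rewrite -e !inE eqxx /= orbF; by apply: contraNneq vA => <-.
  by rewrite !inE aA andbT negb_or negbK => /andP[_ /eqP].
set S1 := [set B in cliques_of h | P B]; set S2 := [set a in A | _].
have -> : [set B in cliques_of h :|: [set v |: A :\ a | a in A] | P B] =
          S1 :|: [set v |: A :\ a | a in S2].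
  apply/setP => B; rewrite !inE andb_orl; congr (_ || _).
  apply/andP/imsetP => [[/imsetP[a aA ->] PB]|[a]].
    by exists a => //; rewrite inE aA.
  by rewrite inE => /andP[aA Pa] ->; split => //; apply: imset_f.
rewrite cardsU (_ : _ :&: _ = set0) ?cards0 ?subn0.
  rewrite card_in_imset // => a b; rewrite !inE => /andP[aA _] /andP[bA _].
  exact: inj.
apply/setP => B; rewrite inE [in RHS]inE; apply/negP => /andP[].
rewrite inE => /andP[Bcl _] /imsetP[a _ eB].
by have := newv_notin _ _ hn Bcl; rewrite eB setU11.
Qed.

Lemma clique_nil : cliques_of [::] = [set [set x : V | x < k]].
Proof.
have ck : #|[set x : V | x < k]| = k.
  rewrite cardsE -sum1_card.
  have kn : k <= N by lia.
  rewrite -[RHS]card_ord -sum1_card.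
  rewrite (eq_bigl (fun x : V => x < k)) //.
  by rewrite -(big_ord_widen_cond _ xpredT (fun=> 1)).
apply/setP => B; rewrite cliques_ofE !inE addn0; apply/and3P/eqP => [[/eqP cB /forall_inP lB _]|->].
  apply/eqP; rewrite eqEcard cB ck leqnn andbT.
  by apply/subsetP => x /lB; rewrite inE.
split; first by rewrite ck.
  by apply/forall_inP => x; rewrite inE.
apply/forall_inP => x; rewrite inE => xk; apply/forall_inP => y; rewrite inE => yk.
by apply/implyP => xy; rewrite /adj inE /= xk yk.
Qed.

(** Every step adds [k] cliques whatever is chosen, so the denominators of all transition
    probabilities are deterministic. *)
Lemma card_cliques_of h : valid h -> #|cliques_of h| = 1 + k * size h.
Proof.
elim: h => [_|A h IH vAh]; first by rewrite clique_nil cards1 muln0.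
have := card_cliques_of_cons xpredT h A vAh.
have e (h' : seq {set V}) : [set B in cliques_of h' | true] = cliques_of h'.
  by apply/setP => B; rewrite inE andbT.
rewrite !e => ->; move: vAh => /= /and3P[Acl hn /IH ->].
have -> : [set a in A | true] = A by apply/setP => x; rewrite inE andbT.
by rewrite (clique_card _ _ Acl); lia.
Qed.

Lemma clique_sub h A : valid (A :: h) -> cliques_of h \subset cliques_of (A :: h).
Proof. by move=> vAh; rewrite clique_cons // subsetUl. Qed.

Lemma leq_card_cliques_of (P Q : pred {set V}) h A : valid (A :: h) ->
  (forall B, B \in cliques_of h -> P B -> Q B) ->
  #|[set B in cliques_of h | P B]| <= #|[set B in cliques_of (A :: h) | Q B]|.
Proof.
move=> vAh PQ; apply: subset_leq_card; apply/subsetP => B; rewrite !inE => /andP[Bh PB].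
by rewrite (PQ B) ?andbT ?(subsetP (clique_sub _ _ vAh)).
Qed.

Lemma card_newv A v : v \notin A ->
  #|[set a in A | v \in v |: (A :\ a)]| = #|A|.
Proof.
by move=> vA; apply: eq_card => a; rewrite !inE eqxx andbT.
Qed.

Lemma card_oldv A v x : v \notin A -> x \in A ->
  #|[set a in A | x \in v |: (A :\ a)]|.+1 = #|A|.
Proof.
move=> vA xA; rewrite [in RHS](cardsD1 x) xA add1n; congr _.+1.
apply: eq_card => a; rewrite !inE xA andbT.
have -> : x == v = false by apply: contraNF vA => /eqP <-.
by rewrite /= andbC eq_sym.
Qed.

(** A new vertex is born in [k] cliques. An initial vertex starts in only one, but the first choice
    is forced to be that clique and adds [k - 1]; hence the condition on [size h]. *)
Lemma geq_card_clique_mem h x : valid h -> 0 < size h -> x < k + size h ->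
  k <= #|[set B in cliques_of h | x \in B]|.
Proof.
elim: h x => [//|A h IH] x vAh _ xlt.
move: (vAh) => /= /and3P[Acl hn vh].
have vA := newv_notin _ _ hn Acl.
rewrite card_cliques_of_cons //=.
have [->|xv] := eqVneq x (newv (size h)).
  by rewrite card_newv // (clique_card _ _ Acl); lia.
have {}xlt : x < k + size h.
  have : x != newv (size h) :> nat by rewrite (inj_eq val_inj).
  by move: xlt; rewrite val_newv //=; lia.
have [h0|h0] := posnP (size h); last exact: leq_trans (IH _ vh h0 xlt) (leq_addr _ _).
have Ax : x \in A.
  case: (h) h0 Acl xlt => // _; rewrite clique_nil inE => /eqP ->.
  by rewrite inE addn0.
have := card_oldv _ _ _ vA Ax; rewrite (clique_card _ _ Acl).
have : 0 < #|[set B in cliques_of h | x \in B]|.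
  by apply/card_gt0P; exists A; rewrite inE Acl.
move=> c0 c1; rewrite -[X in X <= _]c1 -add1n; exact: leq_add.
Qed.

(** Whenever [x] belongs to the chosen clique, its degree grows by one and its number of cliques by
    [k - 1]. Degrees are thus controlled by clique counts. *)
Lemma leq_card_clique_deg h x : valid h ->
  #|[set B in cliques_of h | x \in B]| <= k * #|nbrs N (graph_of h) x|.
Proof.
elim: h x => [|A h IH] x vAh.
  have [xk|xk] := boolP (x < k); last first.
    rewrite (_ : [set B in _ | _] = set0) ?cards0 //.
    by apply/setP => B; rewrite clique_nil !inE; apply/negP => /andP[/eqP ->]; rewrite inE (negbTE xk).
  have l1 : #|[set B in cliques_of [::] | x \in B]| <= 1.
    rewrite -(cards1 [set x : V | x < k]) subset_leq_card //.
    by apply/subsetP => B; rewrite clique_nil inE => /andP[].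
  have : 0 < #|nbrs N (graph_of [::]) x|.
    apply/card_gt0P; have lt b : b < 2 -> b < N by lia.
    (* Vertex 1 serves for [x = 0] and vertex 0 otherwise; both are in the initial clique because
       [k] is at least 2. *)
    exists (if val x == 0 then Ordinal (lt 1 isT) else Ordinal (lt 0 isT)).
    by case: ifP => x0'; rewrite /nbrs inE /adj inE /= xk /= -(inj_eq val_inj) /= ?(eqP x0') ?x0'; lia.
  by nia.
move: (vAh) => /= /and3P[Acl hn vh].
have vA := newv_notin _ _ hn Acl; have cA := clique_card _ _ Acl.
rewrite card_cliques_of_cons //=; set v := newv (size h).
have sub : nbrs N (graph_of h) x \subset nbrs N (graph_of (A :: h)) x.
  by apply/subsetP => y; rewrite !inE /adj graph_of_cons // => ->.
have [xv|xv] := eqVneq x v.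
  rewrite {2}xv card_newv // cA (_ : [set B in cliques_of h | x \in B] = set0).
    rewrite cards0 add0n leq_pmulr // (leq_trans (n := #|A|)) //; first by lia.
    apply: subset_leq_card; apply/subsetP => y yA.
    by rewrite !inE /adj graph_of_cons // xv eqxx yA /= orbT.
  apply/setP => B; rewrite !inE; apply/negP => /andP[Bcl xB].
  by have := newv_notin _ _ hn Bcl; rewrite -/v -xv xB.
have {}IH := IH x vh.
have [xA|xA] := boolP (x \in A); last first.
  rewrite [X in _ + X](_ : _ = 0); last first.
    apply: eq_card0 => a; rewrite !inE (negbTE xv) (negbTE xA) /= andbF.
    by rewrite andbF.
  by rewrite addn0 (leq_trans IH) // leq_mul2l subset_leq_card ?orbT.
have c1 := card_oldv _ _ _ vA xA; rewrite cA in c1.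
have c2 : (#|nbrs N (graph_of h) x|).+1 <= #|nbrs N (graph_of (A :: h)) x|.
  have : v |: nbrs N (graph_of h) x \subset nbrs N (graph_of (A :: h)) x.
    by rewrite subUset sub sub1set !inE /adj graph_of_cons // eqxx xA /= !orbT.
  move/subset_leq_card; rewrite cardsU1 inE /adj (newv_gr h x vh hn).2 /=.
  by rewrite add1n.
apply: (@leq_trans (k * #|nbrs N (graph_of h) x| + k)).
  by apply: leq_add => //; rewrite -[X in _ <= X]c1 leqnSn.
by rewrite -mulnSr leq_mul2l c2 orbT.
Qed.

(** * Roots, and the side grown from each root *)

Fixpoint roots m h : {set {set V}} :=
  if h is A :: h' then if m <= size h' then roots m h' else cliques_of h else cliques_of [::].

Lemma roots_size m h : size h = m -> roots m h = cliques_of h.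
Proof. by case: h => //= A h <-; rewrite ltnn. Qed.

Lemma rootsP m h C : valid h -> m <= size h -> C \in roots m h ->
  [/\ C \in cliques_of h, #|C| = k & forall x, x \in C -> x < k + m].
Proof.
elim: h => [|A h IH] vh; first by case: m => // _ Cc; split => // [|x]; [exact: clique_card Cc|exact: clique_lt Cc].
rewrite leq_eqVlt => /predU1P[->|]; last first.
  rewrite /= ltnS => mh; rewrite mh => /IH; case: (and3P vh) => _ _ vh' /(_ vh' mh) [Cc ? ?].
  by split => //; apply: (subsetP (clique_sub _ _ vh)).
rewrite roots_size // => Cc; split => // [|x]; [exact: clique_card Cc|exact: clique_lt Cc].
Qed.

Lemma card_roots m h : valid h -> m <= size h -> #|roots m h| = 1 + k * m.
Proof.
elim: h => [|A h IH] vh; first by case: m => // _; rewrite card_cliques_of.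
rewrite leq_eqVlt => /predU1P[->|]; first by rewrite roots_size ?card_cliques_of.
by rewrite /= ltnS => mh; rewrite mh IH //; case/and3P: vh.
Qed.

(* The set whose choice makes the root [C] progress. For [#|U| < k] it consists of
   the new vertices [U] and of all but [#|U|] vertices of [C]; for [#|U| >= k] it is
   [U], which is a clique only if [#|U| = k]. *)
Definition frontier C U := U :|: [set x in drop #|U| (enum C)].

(* [U] is the part of the graph grown on the far side of the root [C], and [None]
   means that a clique straddling [U] and its complement has been chosen. *)
Definition step C v A (o : option {set V}) : option {set V} :=
  if o is Some U then
    if (A == frontier C U) || (A \subset U) then Some (v |: U)
    else if [disjoint A & U] then Some U else None
  else None.

Fixpoint side m C h : option {set V} :=
  if h is A :: h' then
    if m <= size h' then step C (newv (size h')) A (side m C h') else Some set0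
  else Some set0.

Lemma frontier0 C : frontier C set0 = C.
Proof. by rewrite /frontier cards0 drop0 set0U; apply/setP => x; rewrite inE mem_enum. Qed.

Lemma sub_frontier C U : U \subset frontier C U.
Proof. exact: subsetUl. Qed.

Lemma frontier_full C U : #|C| = k -> k <= #|U| -> frontier C U = U.
Proof.
move=> cC kU; rewrite /frontier drop_oversize -?cardE ?cC //.
by apply/setP => x; rewrite !inE orbF.
Qed.

(** The vertices of [C] are dropped in the order of [enum C]. When the frontier is chosen, the next
    one in this order is the vertex left out, so the new frontier is among the cliques just
    created. *)
Lemma frontier_step C U v : #|C| = k -> #|U| < k -> [disjoint C & U] -> v \notin U ->
  exists a, [/\ a \in frontier C U, a \notin U & frontier C (v |: U) = v |: (frontier C U :\ a)].
Proof.
move=> cC Uk dCU vU.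
have sz : #|U| < size (enum C) by rewrite -cardE cC.
have dE := drop_nth x0 sz; set a := nth x0 _ _ in dE.
have aC : a \in C by rewrite -mem_enum mem_nth.
have aU : a \notin U by have := disjointFr dCU aC => ->.
exists a; split => //.
  by rewrite /frontier !inE dE mem_head orbT.
have ua : a \notin drop #|U|.+1 (enum C).
  have : uniq (drop #|U| (enum C)) by rewrite drop_uniq // enum_uniq.
  by rewrite dE => /andP[].
rewrite /frontier cardsU1 vU add1n dE; apply/setP => x; rewrite !inE.
have [->|xv] := eqVneq x v => //=.
have [->|xa] //= := eqVneq x a.
by rewrite (negbTE aU) (negbTE ua).
Qed.

(** * Straddling cliques and the invariant of a growing cut *)

Definition mix U B := ~~ [disjoint B & U] && ~~ (B \subset U).
(* The number of straddling cliques when [#|U| = j]. *)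
Definition mixn j := if j < k then j * k else k * k - 1.
Lemma mixn_full j : k <= j -> mixn j = k * k - 1.
Proof. by rewrite /mixn ltnNge => ->. Qed.

(** With fewer than [k] vertices on the side, all [k] cliques created by an advance straddle. *)
Lemma mixn_lt j : j.+1 < k -> mixn j + k = mixn j.+1.
Proof. by move=> jk; rewrite /mixn jk (ltnW jk) mulSn addnC. Qed.

(** The advance to [k] vertices creates one clique that does not straddle, namely the new [U]
    itself. *)
Lemma mixn_last j : j.+1 = k -> mixn j + j = mixn j.+1.
Proof. by move=> jk; rewrite /mixn jk ltnn -jk leqnn; lia. Qed.

(* The cliques at [x] lying entirely on its own side of the cut. *)
Definition Zin h U x := #|[set B in cliques_of h | (x \in B) && (B \subset U)]|.
Definition Zout h U x := #|[set B in cliques_of h | (x \in B) && [disjoint B & U]]|.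
Definition cross h U : {set V * V} := [set p in graph_of h | (p.1 \in U) && (p.2 \notin U)].

(** [inv_bnd] keeps the next advance available and [inv_mix] fixes the death rate. [inv_in] and
    [inv_out] give the urns a start of at least [k], where [phi] is at most 1, and [inv_cross]
    bounds the number of urns. *)
Record inv m C h U : Prop := Inv {
  inv_age : forall x, x \in U -> k + m <= x < k + size h;
  inv_bnd : #|U| <= k -> frontier C U \in cliques_of h;
  inv_mix : #|[set B in cliques_of h | mix U B]| = mixn #|U|;
  inv_in : k < #|U| -> forall x, x \in U -> k <= Zin h U x;
  inv_out : forall x, x \notin U -> x < k + size h -> k <= Zout h U x;
  inv_cross : #|cross h U| <= k * minn #|U| k }.

Lemma crossE h U x y : ((x, y) \in cross h U) = [&& (x, y) \in graph_of h, x \in U & y \notin U].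
Proof. by rewrite in_set. Qed.

Lemma old_disjoint B U v : v \notin B -> [disjoint B & v |: U] = [disjoint B & U].
Proof.
move=> vB; rewrite !disjoints_subset setCU subsetI subsetC sub1set inE.
by rewrite vB.
Qed.

Lemma old_subset B U v : v \notin B -> (B \subset v |: U) = (B \subset U).
Proof.
move=> vB; apply/idP/idP => [/subsetP s|s]; last by rewrite (subset_trans s) // subsetUr.
apply/subsetP => x xB; have := s _ xB; rewrite !inE => /predU1P[e|//].
by rewrite -e xB in vB.
Qed.

Lemma new_disjoint A U v a : v \notin U -> [disjoint A & U] -> [disjoint v |: (A :\ a) & U].
Proof.
move=> vU; rewrite -!setI_eq0 setIUl => /eqP AU.
apply/eqP/setP => x; rewrite !inE; apply/negP => /orP[/andP[/eqP -> ]|/andP[/andP[_ xA] xU]].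
  by rewrite (negbTE vU).
by move/setP/(_ x): AU; rewrite !inE xA xU.
Qed.

Lemma new_subset A U v a : v \notin A ->
  (v |: (A :\ a) \subset v |: U) = (A :\ a \subset U).
Proof.
move=> vA; rewrite subUset sub1set setU11 /= old_subset // !inE negb_and.
by rewrite vA orbT.
Qed.

Lemma new_mix A U v a : v \notin A -> mix (v |: U) (v |: (A :\ a)) = ~~ (A :\ a \subset U).
Proof.
move=> vA; rewrite /mix new_subset // (_ : [disjoint _ & _] = false) //.
by apply/pred0Pn; exists v; rewrite /= !inE eqxx.
Qed.

Lemma old_mix B U v : v \notin B -> mix (v |: U) B = mix U B.
Proof. by move=> vB; rewrite /mix old_disjoint // old_subset. Qed.

Lemma disjoint_sub0 A U : [disjoint A & U] -> A \subset U -> A = set0.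
Proof.
by rewrite -setI_eq0 => /eqP AU /setIidPl <-.
Qed.

Lemma eq_card_cliques_of (P Q : pred {set V}) h :
  (forall B, B \in cliques_of h -> P B = Q B) ->
  #|[set B in cliques_of h | P B]| = #|[set B in cliques_of h | Q B]|.
Proof.
by move=> PQ; apply: eq_card => B; rewrite !inE; case: (boolP (B \in cliques_of h)) => //= Bh; rewrite PQ.
Qed.

Lemma inv_base m h C : 0 < m -> valid h -> size h = m -> C \in cliques_of h ->
  inv m C h set0.
Proof.
move=> m0 vh hm Cc; split.
- by move=> x; rewrite inE.
- by rewrite frontier0.
- rewrite cards0 /mixn mul0n ifT; last by lia.
  by apply: eq_card0 => B; rewrite !inE /mix disjoint_sym disjoints_subset sub0set andbF.
- by rewrite cards0.
- move=> x _ xlt; apply: leq_trans (geq_card_clique_mem _ x vh _ xlt) _; first by rewrite hm.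
  apply: subset_leq_card; apply/subsetP => B; rewrite !inE => /andP[-> ->] /=.
  by rewrite disjoint_sym disjoints_subset sub0set.
- rewrite cards0 min0n muln0 leqn0 cards_eq0; apply/eqP/setP => p.
  by rewrite !inE andbF.
Qed.

(** The vertices of [C] were present at time [m] and those of [U] came later, even if [U] belongs to
    another root. *)
Lemma inv_disjoint_root m h C C' U : C \in roots m h -> valid h -> m <= size h ->
  inv m C' h U -> [disjoint C & U].
Proof.
move=> Cr vh mh [age _ _ _ _ _]; have [_ _ ltC] := rootsP _ _ _ vh mh Cr.
apply/pred0P => x /=; apply/negP => /andP[/ltC xC /age]; lia.
Qed.

(** * One step of the process seen from one root *)

Section OneStep.
Variables (m : nat) (h : seq {set V}) (C U A : {set V}).
Hypotheses (vAh : valid (A :: h)) (mh : m <= size h) (Cr : C \in roots m h).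
Hypothesis iU : inv m C h U.

Let v := newv (size h).

Lemma step_facts : [/\ valid h, size h < n & A \in cliques_of h] /\ [/\ #|A| = k, #|C| = k, v \notin A & v \notin U].
Proof.
have [Acl hn vh] := and3P vAh.
have [_ cC _] := rootsP _ _ _ vh mh Cr.
do 2!split => //; [exact: clique_card Acl | exact: newv_notin|].
by apply/negP => /(inv_age _ _ _ _ iU); rewrite val_newv //; lia.
Qed.

(** Separates the building phase from free growth; at [#|U| = k] the frontier is [U] itself and
    falls under the first case. *)
Lemma growE : (A == frontier C U) || (A \subset U) ->
  A \subset U \/ (A = frontier C U /\ #|U| < k).
Proof.
have [[vh hn Acl] [cA cC vA vU]] := step_facts.
have [|AU] := boolP (A \subset U); first by left.
rewrite orbF => /eqP e; right; split => //.
by rewrite ltnNge; apply: contra AU => /(frontier_full _ _ cC) <-; rewrite -e.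
Qed.

Lemma cross_grow : A \subset U -> cross (A :: h) (v |: U) = cross h U.
Proof.
have [[vh hn Acl] [cA cC vA vU]] := step_facts.
have vgr x := newv_gr h x vh hn.
move=> AU; apply/setP => -[x y]; rewrite !crossE graph_of_cons // -/v !in_setU1 /=.
have [->|xv] := eqVneq x v.
  rewrite (vgr y).1 (negbTE vA) andbF orbF /=; apply/negP => /andP[/(subsetP AU) ->].
  by rewrite orbT.
have [->|yv] := eqVneq y v; first by rewrite ?eqxx (vgr x).2 /= !andbF.
by rewrite !orbF.
Qed.

Lemma cross_stay : [disjoint A & U] -> cross (A :: h) U = cross h U.
Proof.
have [[vh hn Acl] [cA cC vA vU]] := step_facts.
have vgr x := newv_gr h x vh hn.
move=> AU; apply/setP => -[x y]; rewrite !crossE graph_of_cons // -/v /=.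
have [->|xv] := eqVneq x v; first by rewrite (negbTE vU) !andbF.
have [->|yv] := eqVneq y v; last by rewrite !orbF.
rewrite (vgr x).2 /=; apply/negP => /and3P[xA xU _].
by rewrite (disjointFr AU xA) in xU.
Qed.

Lemma inv_grow : (A == frontier C U) || (A \subset U) -> inv m C (A :: h) (v |: U).
Proof.
have [[vh hn Acl] [cA cC vA vU]] := step_facts.
have vB B : B \in cliques_of h -> v \notin B by apply: newv_notin.
have vgr := newv_gr h _ vh hn.
move=> /growE gE.
have cU' : #|v |: U| = #|U|.+1 by rewrite cardsU1 vU.
have big : A \subset U -> k <= #|U| by move/subset_leq_card; rewrite cA.
have dCU : [disjoint C & U] by apply: inv_disjoint_root iU.
split; rewrite ?cU'.
- move=> x /setU1P[->|/(inv_age _ _ _ _ iU)] /=; last by lia.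
  by rewrite val_newv //; lia.
- move=> Uk; case: gE => [/big|[eA _]]; first by rewrite leqNgt Uk.
  have [a [aA aU ->]] := frontier_step _ _ _ cC Uk dCU vU.
  rewrite clique_cons // -/v -eA in_setU; apply/orP; right.
  by apply/imsetP; exists a; rewrite ?eA.
- rewrite card_cliques_of_cons //= (eq_card_cliques_of _ (mix U)) => [|B /vB vB']; last exact: old_mix.
  rewrite (inv_mix _ _ _ _ iU).
  rewrite (_ : [set a in A | _] = [set a in A | ~~ (A :\ a \subset U)]); last first.
    by apply/setP => a; rewrite !inE new_mix.
  case: gE => [AU|[eA Uk]].
    rewrite (_ : [set a in A | _] = set0); last first.
      by apply/setP => a; rewrite !inE (subset_trans _ AU) ?andbF // subsetDl.
    by rewrite cards0 addn0 !mixn_full ?leqW ?big.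
  have [a [aA aU _]] := frontier_step _ _ _ cC Uk dCU vU; rewrite -eA in aA.
  have UA : U \subset A by rewrite eA sub_frontier.
  (* [A :\ b] has [k - 1] elements, too many for [U] unless [#|U|.+1 = k]. In that case
     [U = A :\ a], and only the clique leaving out [a] falls inside. *)
  have [Uk1|Uk1] := ltnP #|U|.+1 k.
    rewrite (_ : [set a in A | _] = A) ?cA; first exact: mixn_lt.
    apply/setP => b; rewrite !inE; case: (boolP (b \in A)) => //= bA.
    apply/negP => /subset_leq_card; have := cardsD1 b A; rewrite bA cA add1n leqNgt => e.
    by rewrite -ltnS -e Uk1.
  have cD : #|A :\ a|.+1 = k by rewrite -cA (cardsD1 a A) aA.
  have eU : U = A :\ a.
    by apply/eqP; rewrite eqEcard subsetD1 UA aU /= -ltnS cD.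
  rewrite (_ : [set b in A | _] = A :\ a).
    rewrite -eU; apply: mixn_last; rewrite eU.
    exact: cD.
  apply/setP => b; rewrite !inE andbC [RHS]andbC; case: (boolP (b \in A)) => bA; rewrite ?andbF //= !andbT.
  rewrite eU; have [->|ba] := eqVneq b a; first by rewrite subxx.
  apply/negP => /subsetP /(_ a); rewrite !inE eqxx eq_sym ba aA /=.
  by move/(_ isT).
- move=> kU x xU'; have AU : A \subset U by case: gE => [//|[_]]; rewrite ltnNge -ltnS kU.
  rewrite /Zin card_cliques_of_cons //= -/v.
  have [ex|xv] := eqVneq x v.
    rewrite ex -[X in X <= _]cA.
    apply: leq_trans (leq_addl _ _); apply: subset_leq_card; apply/subsetP => a.
    by move=> aA; rewrite inE aA setU11 new_subset // (subset_trans _ AU) // subsetDl.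
  have xU : x \in U by move: xU'; rewrite in_setU1 (negbTE xv).
  (* At [#|U| = k] the chosen clique is [U] itself. A vertex of it then lies in this clique and in
     the [k - 1] new ones that keep it. *)
  move: kU; rewrite ltnS leq_eqVlt => /predU1P[kU|kU]; last first.
    apply: leq_trans (inv_in _ _ _ _ iU kU x xU) _; apply: leq_trans (leq_addr _ _).
    by rewrite leq_eqVlt; apply/orP; left; apply/eqP; apply: eq_card_cliques_of => B /vB ?; rewrite old_subset.
  have eA : A = U by apply/eqP; rewrite eqEcard AU cA kU /=.
  have xA : x \in A by rewrite eA.
  have c1 : 0 < #|[set B in cliques_of h | (x \in B) && (B \subset v |: U)]|.
    by apply/card_gt0P; exists A; rewrite !inE Acl xA eA subsetUr.
  have := card_oldv _ _ _ vA xA; rewrite cA.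
  move=> c2; rewrite -[X in X <= _]c2 -add1n; apply: leq_add => //.
  apply: subset_leq_card; apply/subsetP => a.
  by rewrite !inE => /andP[aA ->]; rewrite aA new_subset // eA subsetDl.
- move=> x; rewrite in_setU1 negb_or => /andP[xv xU] xlt.
  have {}xlt : x < k + size h.
    by move: xv xlt; rewrite -(inj_eq val_inj) /= val_newv //; lia.
  apply: leq_trans (inv_out _ _ _ _ iU x xU xlt) _.
  by apply: leq_card_cliques_of => // B /vB ?; rewrite old_disjoint.
- case: gE => [AU|[eA Uk]].
    have -> : minn #|U|.+1 k = minn #|U| k by rewrite !(minn_idPr _) ?leqW ?big.
    by rewrite cross_grow //; exact: inv_cross iU.
  (* In the building phase every new cut edge joins [v] to a vertex of [A]. *)
  have -> : k * minn #|U|.+1 k = k * minn #|U| k + k by rewrite !(minn_idPl _) ?mulnSr // ltnW.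
  apply: leq_trans (leq_add (inv_cross _ _ _ _ iU) (leqnn k)).
  rewrite -[X in _ <= _ + X]cA -(card_imset (mem A) (f := pair v)) => [|x y []//].
  apply: leq_trans (leq_card_setU _ _); apply: subset_leq_card.
  apply/subsetP => -[x y]; rewrite crossE graph_of_cons // -/v in_setU crossE /=.
  case/and3P => /or3P[xy|/andP[/eqP -> yA] _ _|/andP[/eqP -> _] _].
  - have [xv yv] : x != v /\ y != v.
      by split; apply: contraTneq xy => ->; rewrite vgr.
    by rewrite !in_setU1 (negbTE xv) (negbTE yv) xy /= => -> ->.
  - by apply/orP; right; apply: imset_f.
  - by rewrite setU11.
Qed.

Lemma inv_stay : [disjoint A & U] -> inv m C (A :: h) U.
Proof.
have [[vh hn Acl] [cA cC vA vU]] := step_facts.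
move=> AU; split.
- by move=> x /(inv_age _ _ _ _ iU) /=; lia.
- by move/(inv_bnd _ _ _ _ iU); apply/subsetP/clique_sub.
- rewrite card_cliques_of_cons //= (inv_mix _ _ _ _ iU) [X in _ + X](_ : _ = 0) ?addn0 //.
  by apply: eq_card0 => a; rewrite !inE /mix new_disjoint // andbF.
- move=> kU x xU; apply: leq_trans (inv_in _ _ _ _ iU kU x xU) _.
  exact: leq_card_cliques_of.
- move=> x xU xlt; have [ex|xv] := eqVneq x v.
    rewrite /Zout card_cliques_of_cons //= -/v; apply: leq_trans (leq_addl _ _).
    rewrite ex -[X in X <= _]cA.
    apply: subset_leq_card; apply/subsetP => a aA.
    by rewrite inE aA setU11 new_disjoint.
  have {}xlt : x < k + size h.
    by move: xv xlt; rewrite -(inj_eq val_inj) /= val_newv //; lia.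
  apply: leq_trans (inv_out _ _ _ _ iU x xU xlt) _.
  exact: leq_card_cliques_of.
- by rewrite cross_stay //; exact: inv_cross iU.
Qed.

(** The urn transition: choosing a clique at [x] creates [k - 1] more at [x], those that do not omit
    it. *)
Lemma Zin_grow x : A \subset U -> x \in U ->
  Zin h U x + (k - 1) * (x \in A) <= Zin (A :: h) (v |: U) x.
Proof.
have [[vh hn Acl] [cA cC vA vU]] := step_facts.
move=> AU xU; rewrite /Zin card_cliques_of_cons //= -/v; apply: leq_add.
  rewrite leq_eqVlt; apply/orP; left; apply/eqP; apply: eq_card_cliques_of => B Bh.
  by rewrite old_subset // newv_notin.
case: (boolP (x \in A)) => xA; rewrite ?muln0 ?muln1 //.
rewrite -[X in X - 1]cA -(card_oldv _ _ _ vA xA) subn1 /=.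
apply: subset_leq_card; apply/subsetP => a.
by rewrite !inE => /andP[aA ->]; rewrite aA new_subset // (subset_trans _ AU) // subsetDl.
Qed.

Lemma Zin_stay x : Zin h U x <= Zin (A :: h) U x.
Proof. exact: leq_card_cliques_of. Qed.

Lemma Zout_grow x : Zout h U x <= Zout (A :: h) (v |: U) x.
Proof.
have [[vh hn Acl] [cA cC vA vU]] := step_facts.
by apply: leq_card_cliques_of => // B Bh; rewrite old_disjoint // newv_notin.
Qed.

Lemma Zout_stay x : [disjoint A & U] -> x \notin U ->
  Zout h U x + (k - 1) * (x \in A) <= Zout (A :: h) U x.
Proof.
have [[vh hn Acl] [cA cC vA vU]] := step_facts.
move=> AU xU; rewrite /Zout card_cliques_of_cons //= -/v leq_add2l.
case: (boolP (x \in A)) => xA; rewrite ?muln0 ?muln1 //.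
rewrite -[X in X - 1]cA -(card_oldv _ _ _ vA xA) subn1 /=.
apply: subset_leq_card; apply/subsetP => a.
by rewrite !inE => /andP[aA ->]; rewrite aA new_disjoint.
Qed.

End OneStep.

Lemma side_inv m h C U : 0 < m -> valid h -> m <= size h -> C \in roots m h ->
  side m C h = Some U -> inv m C h U.
Proof.
move=> m0; elim: h U => [|A h IH] U vh mh Cr; first by case: (m) m0 mh.
move: mh Cr; rewrite leq_eqVlt ltnS => /orP[/eqP em|mh] Cr.
  rewrite /= em /= ltnn => -[<-]; apply: inv_base => //.
  by rewrite -(roots_size m).
move: Cr; rewrite /= mh => Cr.
have [_ _ vh'] := and3P vh.
case E: (side m C h) => [W|] //=; have iW := IH W vh' mh Cr E.
case: ifP => [g [<-]|g]; first exact: inv_grow.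
by case: ifP => // dj [<-]; exact: inv_stay.
Qed.

(** * No choice affects two roots *)

Definition act C U A := (A == frontier C U) || ~~ [disjoint A & U].

Lemma disjoint0 A : [disjoint A & (set0 : {set V})].
Proof. by rewrite disjoint_sym disjoints_subset sub0set. Qed.

Lemma act0 C A : act C set0 A = (A == C).
Proof. by rewrite /act frontier0 disjoint0 orbF. Qed.

Lemma act_meets C U A : U != set0 -> act C U A = ~~ [disjoint A & U].
Proof.
move=> /set0Pn[x xU]; rewrite /act; case: eqP => //= ->.
by symmetry; apply/negP => /disjointFr/(_ (subsetP (sub_frontier _ _) _ xU)); rewrite xU.
Qed.

Lemma step_idle C U A v : A != set0 -> ~~ act C U A -> step C v A (Some U) = Some U.
Proof.
rewrite /act negb_or negbK => A0 /andP[/negbTE AB AU]; rewrite /= AB /= AU.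
by case: ifP => // /(disjoint_sub0 _ _ AU) e; rewrite e eqxx in A0.
Qed.

Lemma side_cons m C A h : m <= size h -> side m C (A :: h) = step C (newv (size h)) A (side m C h).
Proof. by move=> mh; rewrite /= mh. Qed.

(** An empty side reacts only to its own root, which is too old to meet the other side. A nonempty
    side reacts only to the cliques that meet it, and by hypothesis no clique meets both. *)
Lemma act_unique m h C C' U U' A : valid h -> m <= size h ->
  C \in roots m h -> C' \in roots m h -> C != C' ->
  inv m C h U -> inv m C' h U' ->
  (forall B, B \in cliques_of h -> [disjoint B & U] || [disjoint B & U']) ->
  A \in cliques_of h -> ~~ (act C U A && act C' U' A).
Proof.
move=> vh mh Cr Cr' CC iU iU' dj Acl.
have [->|U0] := eqVneq U set0.
  rewrite act0; apply/negP => /andP[/eqP ->].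
  have [->|U0'] := eqVneq U' set0; first by rewrite act0 (negbTE CC).
  by rewrite act_meets // (inv_disjoint_root _ _ _ _ _ Cr vh mh iU').
have [->|U0'] := eqVneq U' set0.
  rewrite act0 act_meets //; apply/negP => /andP[/[swap] /eqP ->].
  by rewrite (inv_disjoint_root _ _ _ _ _ Cr' vh mh iU).
by rewrite !act_meets // -negb_or negbK dj.
Qed.

(** Induction together with [act_unique]: one of the two roots is idle, so [A], the new vertex and
    hence all new cliques avoid its side. *)
Lemma side_pair m h C C' U U' : 0 < m -> valid h -> m <= size h ->
  C \in roots m h -> C' \in roots m h -> C != C' ->
  side m C h = Some U -> side m C' h = Some U' ->
  forall B, B \in cliques_of h -> [disjoint B & U] || [disjoint B & U'].
Proof.
move=> m0; elim: h U U' => [|A h IH] U U' vh mh Cr Cr' CC; first by case: (m) m0 mh.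
move: mh Cr Cr'; rewrite leq_eqVlt ltnS => /orP[/eqP em|mh] Cr Cr'.
  by rewrite /= em /= ltnn => -[<-] _ B _; rewrite disjoint0.
move: Cr Cr'; rewrite !side_cons //= mh => Cr Cr'.
have [Acl hn vh'] := and3P vh.
case E: (side m C h) => [W|] //; case E': (side m C' h) => [W'|] //.
have {}IH := IH W W' vh' mh Cr Cr' CC E E'.
have iW := side_inv _ _ _ _ m0 vh' mh Cr E; have iW' := side_inv _ _ _ _ m0 vh' mh Cr' E'.
have [_ [_ _ vA vW]] := step_facts _ _ _ _ _ vh mh Cr iW.
have [_ [_ _ _ vW']] := step_facts _ _ _ _ _ vh mh Cr' iW'.
have A0 := clique_neq0 _ _ Acl.
have old D X Y B : step D (newv (size h)) A (Some X) = Some Y -> B \in cliques_of h ->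
    [disjoint B & Y] = [disjoint B & X].
  move=> + Bcl; rewrite /=; case: ifP => _; last by case: ifP => // _ [<-].
  by move=> [<-]; rewrite old_disjoint // newv_notin.
have idle D X : ~~ act D X A -> [disjoint A & X].
  by rewrite negb_or negbK => /andP[].
have := act_unique _ _ _ _ _ _ _ vh' mh Cr Cr' CC iW iW' IH Acl.
rewrite negb_and => ne S S' B; rewrite clique_cons // in_setU => /orP[Bcl|/imsetP[a aA ->]].
  by rewrite (old _ _ _ _ S) // (old _ _ _ _ S') // IH.
case/orP: ne => na; [move: S | move: S']; rewrite step_idle // => -[<-].
  by rewrite new_disjoint // (idle _ _ na).
by rewrite orbC new_disjoint // (idle _ _ na).
Qed.

(** * Counting the choices that lead from stage to stage *)

(* Stage [k.+1] collects all [U] with more than [k] vertices: the cut no longer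
   changes and [#|U|] is irrelevant. *)
Definition at_stage m a C h := if side m C h is Some U then minn #|U| k.+1 == a else false.
Definition at_prev_stage m a C h := if a is a'.+1 then at_stage m a' C h else false.
(** The number of choices that take a root out of stage [a]: the root itself for [a = 0]; for
    [0 < a < k] the straddling cliques, the frontier being one of them; for [a = k] the [k * k - 1]
    straddling cliques and [U]; afterwards the straddling ones only. *)
Definition alpha a := if a == 0 then 1 else if a <= k then a * k else k * k - 1.

Lemma idle_one m h C C' A : 0 < m -> valid (A :: h) -> m <= size h ->
  C \in roots m h -> C' \in roots m h -> C != C' ->
  side m C (A :: h) = side m C h \/ side m C' (A :: h) = side m C' h.
Proof.
move=> m0 vAh mh Cr Cr' CC; have [Acl hn vh] := and3P vAh.
rewrite !side_cons //.
case E: (side m C h) => [U|]; last by left.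
case E': (side m C' h) => [U'|]; last by right.
have iU := side_inv _ _ _ _ m0 vh mh Cr E; have iU' := side_inv _ _ _ _ m0 vh mh Cr' E'.
have dj := side_pair _ _ _ _ _ _ m0 vh mh Cr Cr' CC E E'.
have := act_unique _ _ _ _ _ _ _ vh mh Cr Cr' CC iU iU' dj Acl.
by rewrite negb_and => /orP[] na; [left|right]; apply: step_idle => //; exact: clique_neq0 Acl.
Qed.

Lemma card_act m h C U : valid h -> m <= size h -> C \in roots m h -> inv m C h U ->
  #|U| <= k -> #|[set A in cliques_of h | act C U A]| = alpha #|U|.
Proof.
move=> vh mh Cr iU Uk; have [Cc cC _] := rootsP _ _ _ vh mh Cr.
have [->|U0] := eqVneq U set0.
  rewrite cards0 /alpha eqxx (_ : [set A in _ | _] = [set C]) ?cards1 //.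
  by apply/setP => A; rewrite !inE act0 andbC; case: eqP => // ->.
rewrite /alpha cards_eq0 (negbTE U0) Uk.
move: Uk; rewrite leq_eqVlt => /orP[/eqP Uk|Uk].
  have bU : frontier C U = U by apply: frontier_full; rewrite ?Uk.
  have Ucl : U \in cliques_of h by rewrite -bU; apply: inv_bnd iU _; rewrite Uk.
  rewrite (_ : [set A in _ | _] = U |: [set A in cliques_of h | mix U A]).
    rewrite cardsU1 (inv_mix _ _ _ _ iU) in_set /mix subxx andbF andbF /=.
    by rewrite mixn_full Uk // subnKC // muln_gt0; lia.
  apply/setP => A; rewrite in_setU1 !in_set act_meets // /mix.
  have [->|AU] := eqVneq A U.
    by rewrite Ucl -setI_eq0 setIid U0.
  case: (boolP (A \in cliques_of h)) => //= Acl.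
  have -> : A \subset U = false; last by rewrite andbT.
  apply: contraNF AU => AU; rewrite eqEcard AU Uk.
  by rewrite (clique_card _ _ Acl) leqnn.
rewrite (eq_card_cliques_of _ (mix U)) ?(inv_mix _ _ _ _ iU) /mixn ?Uk // => A Acl.
rewrite act_meets // /mix.
have -> : A \subset U = false; last by rewrite andbT.
by apply/negP => /subset_leq_card; rewrite (clique_card _ _ Acl) leqNgt Uk.
Qed.

Lemma card_splitC (P : pred {set V}) (S : {set {set V}}) :
  #|[set A in S | P A]| + #|[set A in S | ~~ P A]| = #|S|.
Proof.
rewrite -[RHS](cardsID [set A | P A]); congr (_ + _); apply: eq_card => A; rewrite !inE //.
exact: andbC.
Qed.

Lemma side_consE m C A h U : m <= size h -> valid (A :: h) -> C \in roots m h ->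
  inv m C h U -> side m C h = Some U -> forall a,
  at_stage m a C (A :: h) =
  if (A == frontier C U) || (A \subset U) then minn #|U|.+1 k.+1 == a
  else [disjoint A & U] && (minn #|U| k.+1 == a).
Proof.
move=> mh vAh Cr iU E a; have [_ [_ _ vA vU]] := step_facts _ _ _ _ _ vAh mh Cr iU.
rewrite /at_stage side_cons // E /=; case: ifP => _; first by rewrite cardsU1 vU.
by case: ifP.
Qed.

(** Up to stage [k] exactly one choice, the frontier, advances the root, and all other choices that
    act kill it. The transition counts thus depend on the stage and the time alone, not on the shape
    of the graph. *)
Lemma at_stage_step m a C h : 0 < m -> valid h -> size h < n -> m <= size h ->
  C \in roots m h -> a <= k.+1 ->
  #|[set A in cliques_of h | at_stage m a C (A :: h)]| + alpha a * at_stage m a C h =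
  (1 + k * size h) * at_stage m a C h + at_prev_stage m a C h.
Proof.
move=> m0 vh hn mh Cr ak.
have vA A : A \in cliques_of h -> valid (A :: h) by move=> Acl; apply/and3P.
case E: (side m C h) => [U|]; last first.
  have -> b : at_stage m b C h = false by rewrite /at_stage E.
  rewrite /at_prev_stage /at_stage E; rewrite (_ : [set A in _ | _] = set0).
    by rewrite cards0 !muln0; case: (a).
  by apply/setP => A; rewrite in_set in_set0 side_cons // E andbF.
have iU := side_inv _ _ _ _ m0 vh mh Cr E.
have [Cc cC _] := rootsP _ _ _ vh mh Cr.
have indE b : at_stage m b C h = (minn #|U| k.+1 == b) by rewrite /at_stage E.
have [Uk|kU] := leqP #|U| k.
  have UkE : minn #|U| k.+1 = #|U| by apply/minn_idPl; rewrite leqW.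
  have stp A : A \in cliques_of h -> at_stage m a C (A :: h) =
      if A == frontier C U then #|U|.+1 == a else [disjoint A & U] && (#|U| == a).
    move=> Acl; rewrite (side_consE _ _ _ _ _ mh (vA _ Acl) Cr iU E).
    rewrite UkE (minn_idPl _) //; case: eqP => //= AB; case: ifP => // AU.
    (* A clique inside a side of at most [k] vertices fills it, and is then the frontier. *)
    have eA : A = U.
      apply/eqP; rewrite eqEcard AU (clique_card _ _ Acl) //.
    case: AB; rewrite {1}eA frontier_full // -eA.
    by rewrite (clique_card _ _ Acl).
  have Bcl := inv_bnd _ _ _ _ iU Uk.
  rewrite (eq_card_cliques_of _ _ _ stp) indE UkE.
  have [ea|ea] := eqVneq #|U| a.
    rewrite muln1 muln1 -(card_cliques_of _ vh) -(card_splitC (act C U) (cliques_of h)).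
    rewrite (card_act _ _ _ _ vh mh Cr iU Uk) ea addnC.
    have -> : at_prev_stage m a C h = false by case: (a) ea => //= a' e; rewrite indE UkE e gtn_eqF.
    rewrite addn0; congr (_ + _); apply: eq_card_cliques_of => A Acl.
    by rewrite gtn_eqF // /act andbT negb_or negbK; case: eqP.
  rewrite !muln0 add0n addn0.
  have [ea'|ea'] := eqVneq #|U|.+1 a.
    rewrite -ea' /= indE UkE eqxx (_ : [set A in _ | _] = [set frontier C U]) ?cards1 //.
    apply/setP => A; rewrite !inE andbF; case: eqP => [->|]; rewrite ?Bcl ?andbF //.
  rewrite (_ : [set A in _ | _] = set0); last first.
    by apply/setP => A; rewrite !inE andbF if_same andbF.
  rewrite cards0; case: (a) ea' => //= a'; rewrite indE UkE eqSS.
  by move/negbTE->.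
have UkE : minn #|U| k.+1 = k.+1 by apply/minn_idPr.
have UkE' : minn #|U|.+1 k.+1 = k.+1 by apply/minn_idPr; rewrite leqW.
have stp A : A \in cliques_of h -> at_stage m a C (A :: h) = ~~ mix U A && (k.+1 == a).
  move=> Acl; rewrite (side_consE _ _ _ _ _ mh (vA _ Acl) Cr iU E) UkE UkE' /mix.
  rewrite negb_and !negbK.
  have -> : A == frontier C U = false.
    apply/eqP => eA; have := clique_card _ _ Acl; rewrite eA frontier_full // ?(ltnW kU) // => e.
    by rewrite e ltnn in kU.
  by case: (A \subset U); rewrite ?orbT ?orbF.
rewrite (eq_card_cliques_of _ _ _ stp) indE UkE.
have -> : at_prev_stage m a C h = false.
  by case: (a) ak => //= a' ak; rewrite indE UkE gtn_eqF.
have [ea|ea] := eqVneq k.+1 a; last first.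
  rewrite !muln0 addn0 (_ : [set A in _ | _] = set0) ?cards0 //.
  by apply/setP => A; rewrite !inE andbF andbF.
rewrite !muln1 addn0 -(card_cliques_of _ vh) -(card_splitC (mix U) (cliques_of h)) addnC.
congr (_ + _).
  by rewrite (inv_mix _ _ _ _ iU) mixn_full 1?ltnW // /alpha -ea /= ltnn.
by apply: eq_card_cliques_of => A _; rewrite andbT.
Qed.

(* Stage [k.+1] is reached by time [m2] and the root is not dead. *)
Fixpoint alive m m2 C h : bool :=
  at_stage m k.+1 C h && (if h is A :: h' then (m2 <= size h') ==> alive m m2 C h' else true).

Lemma alive_ind m m2 C h : alive m m2 C h -> at_stage m k.+1 C h.
Proof. by case: h => [|A h] /= /andP[]. Qed.

Lemma alive_cons m m2 C A h : m2 <= size h ->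
  alive m m2 C (A :: h) = at_stage m k.+1 C (A :: h) && alive m m2 C h.
Proof. by move=> mh; rewrite /= mh. Qed.

Lemma alive_size m m2 C h : size h = m2 -> alive m m2 C h = at_stage m k.+1 C h.
Proof. by case: h => [|A h] /= hm; rewrite ?andbT // -hm ltnn /= andbT. Qed.

Lemma alive_step m m2 C h : 0 < m -> valid h -> size h < n -> m <= m2 -> m2 <= size h ->
  C \in roots m h ->
  #|[set A in cliques_of h | alive m m2 C (A :: h)]| + (k * k - 1) * alive m m2 C h =
  (1 + k * size h) * alive m m2 C h.
Proof.
move=> m0 vh hn m12 mh Cr.
case: (boolP (alive m m2 C h)) => surv_ind; last first.
  rewrite !muln0 addn0; apply: eq_card0 => A; rewrite in_set alive_cons //.
  by rewrite (negbTE surv_ind) !andbF.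
have := at_stage_step m k.+1 C h m0 vh hn (leq_trans m12 mh) Cr (leqnn _).
have i1 := alive_ind _ _ _ _ surv_ind; rewrite i1 /alpha /= ltnn /at_prev_stage.
have -> : at_stage m k C h = false.
  by move: i1; rewrite /at_stage; case: (side m C h) => // U /eqP ->; rewrite gtn_eqF.
rewrite addn0 => <-; congr (_ + _); apply: eq_card_cliques_of => A _.
by rewrite mh surv_ind andbT.
Qed.


(** * First and second moments *)

Section Expectation.
Local Open Scope ring_scope.
Variable R : realType.
Implicit Types (F G : seq {set V} -> R).

Definition avg F h : R := (#|cliques_of h|%:R)^-1 * \sum_(A in cliques_of h) F (A :: h).

(** The last choice is averaged first: [avg F] is the conditional expectation of [F] given the
    earlier choices. *)
Fixpoint EV t F : R := if t is t'.+1 then EV t' (avg F) else F [::].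

Lemma avg_le F G h : valid h -> (size h < n)%N ->
  (forall h', valid h' -> size h' = (size h).+1 -> F h' <= G h') -> avg F h <= avg G h.
Proof.
move=> vh hn FG; rewrite /avg ler_wpM2l ?invr_ge0 ?ler0n // ler_sum // => A Acl.
by apply: FG => //=; apply/and3P.
Qed.

Lemma EV_le t F G : (t <= n)%N ->
  (forall h, valid h -> size h = t -> F h <= G h) -> EV t F <= EV t G.
Proof.
elim: t F G => [|t IH] F G tn FG /=; first exact: FG.
apply: IH => [|h vh ht]; first exact: ltnW.
by apply: avg_le; rewrite ?ht.
Qed.

Lemma EV_eq t F G : (t <= n)%N ->
  (forall h, valid h -> size h = t -> F h = G h) -> EV t F = EV t G.
Proof. by move=> tn FG; apply/eqP; rewrite eq_le !EV_le // => h vh ht; rewrite FG. Qed.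

Lemma EVD t F G : EV t (fun h => F h + G h) = EV t F + EV t G.
Proof.
elim: t F G => [//|t IH] F G /=; rewrite -IH; congr (EV t _).
by apply/boolp.funext => h; rewrite /avg big_split mulrDr.
Qed.

Lemma EVZ t (c : R) F : EV t (fun h => c * F h) = c * EV t F.
Proof.
elim: t F => [//|t IH] F /=; rewrite -IH; congr (EV t _).
by apply/boolp.funext => h; rewrite /avg -mulr_sumr mulrCA.
Qed.

Definition ncl t : R := (1 + k * t)%:R.

Lemma ncl_gt0 t : 0 < ncl t.
Proof. by rewrite /ncl ltr0n. Qed.

Lemma avgE F h : valid h -> avg F h = (ncl (size h))^-1 * \sum_(A in cliques_of h) F (A :: h).
Proof. by move=> vh; rewrite /avg card_cliques_of. Qed.

Lemma EV_cst t (c : R) : (t <= n)%N -> EV t (fun=> c) = c.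
Proof.
elim: t => [//|t IH] tn /=; rewrite -[RHS](IH (ltnW tn)).
apply: EV_eq; rewrite ?(ltnW tn) // => h vh ht.
by rewrite avgE // sumr_const card_cliques_of // -mulr_natl mulrA mulVf ?mul1r // gt_eqF ?ncl_gt0.
Qed.

(** [kt_ev] branches from the first choice on, [EV] averages from the last one back; passing steps
    over one at a time identifies them. *)
Lemma kt_ev_EV (F : graph N -> R) s t : (s + t <= n)%N ->
  EV t (fun h => kt_ev R N k F s t (graph_of h)) = EV (s + t) (fun h => F (graph_of h)).
Proof.
elim: s t => [//|s IH] t stn.
rewrite addSn -addnS -IH ?addnS //=; apply: EV_eq => [|h vh ht]; first by lia.
rewrite /avg cliques_ofE ht; congr (_ * _); apply: eq_bigr => A _.
by rewrite /graph_of -/graph_of ht.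
Qed.

(* One step changes at most one of [F] and [G], so the product of their increments
   vanishes. *)
Lemma avg_mul F G h : valid h ->
  (forall A, A \in cliques_of h -> F (A :: h) = F h \/ G (A :: h) = G h) ->
  avg (fun h => F h * G h) h = G h * avg F h + F h * avg G h - F h * G h.
Proof.
move=> vh FG; rewrite !avgE //.
have n0 : ncl (size h) != 0 by rewrite gt_eqF ?ncl_gt0.
have -> : \sum_(A in cliques_of h) F (A :: h) * G (A :: h) =
  G h * (\sum_(A in cliques_of h) F (A :: h)) + F h * (\sum_(A in cliques_of h) G (A :: h))
  - ncl (size h) * (F h * G h).
  rewrite /ncl -card_cliques_of // mulr_natl -sumr_const !mulr_sumr -big_split -sumrB /=.
  apply: eq_bigr => A /FG [] ->; ring.
by move: (ncl (size h)) n0 => T n0; field.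
Qed.

(** * First and second moments of the number of roots in each stage *)

Variables (m m2 : nat).
Hypothesis m0 : (0 < m)%N.

Lemma sum_ind (S : {set {set V}}) (P : pred {set V}) :
  \sum_(A in S) (P A)%:R = #|[set A in S | P A]|%:R :> R.
Proof.
rewrite -natr_sum -sum1_card; congr _%:R.
rewrite big_mkcond [RHS]big_mkcond /=; apply: eq_bigr => A _; rewrite inE.
by case: (A \in S) => //; case: (P A).
Qed.

Definition rate a : R := (alpha a)%:R.
Definition stage_ind a C h : R := (at_stage m a C h)%:R.
Definition prev_stage_ind a C h : R := (at_prev_stage m a C h)%:R.

Lemma avg_stage_ind a C h : valid h -> (size h < n)%N -> (m <= size h)%N -> C \in roots m h ->
  (a <= k.+1)%N ->
  avg (stage_ind a C) h =
  (1 - rate a / ncl (size h)) * stage_ind a C h + prev_stage_ind a C h / ncl (size h).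
Proof.
move=> vh hn mh Cr ak; have n0 : ncl (size h) != 0 by rewrite gt_eqF ?ncl_gt0.
rewrite avgE // /stage_ind sum_ind.
have /(congr1 (fun j => j%:R : R)) := at_stage_step m a C h m0 vh hn mh Cr ak.
rewrite !natrD !natrM -/(ncl _) -/(rate _) -/(prev_stage_ind _ _ _) => e.
have -> : #|[set A in cliques_of h | at_stage m a C (A :: h)]|%:R =
   ncl (size h) * (at_stage m a C h)%:R + prev_stage_ind a C h - rate a * (at_stage m a C h)%:R.
  by rewrite /ncl natrD natrM; lra.
by move: (ncl (size h)) n0 => T n0; field.
Qed.

Definition sumr (g : {set V} -> seq {set V} -> R) h := \sum_(C in roots m h) g C h.
Definition pairr (g g' : {set V} -> seq {set V} -> R) h :=
  \sum_(C in roots m h) \sum_(C' in roots m h | C' != C) g C h * g' C' h.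

Lemma roots_cons A h : (m <= size h)%N -> roots m (A :: h) = roots m h.
Proof. by move=> mh; rewrite /= mh. Qed.

Lemma avg_sumr g h : (m <= size h)%N ->
  avg (sumr g) h = \sum_(C in roots m h) avg (g C) h.
Proof.
move=> mh; rewrite /avg -mulr_sumr exchange_big /=; congr (_ * _).
by apply: eq_bigr => A _; rewrite /sumr roots_cons.
Qed.

Lemma avg_pairr g g' h : valid h -> (m <= size h)%N ->
  (forall C C' A, C \in roots m h -> C' \in roots m h -> C != C' -> A \in cliques_of h ->
     g C (A :: h) = g C h \/ g' C' (A :: h) = g' C' h) ->
  avg (pairr g g') h =
  \sum_(C in roots m h) \sum_(C' in roots m h | C' != C)
    (g' C' h * avg (g C) h + g C h * avg (g' C') h - g C h * g' C' h).
Proof.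
move=> vh mh idle; transitivity
  (\sum_(C in roots m h) \sum_(C' in roots m h | C' != C) avg (fun h => g C h * g' C' h) h).
  rewrite /avg; under [RHS]eq_bigr => C _ do rewrite -mulr_sumr exchange_big /=.
  rewrite -mulr_sumr exchange_big /=; congr (_ * _).
  by apply: eq_bigr => A _; rewrite /pairr roots_cons.
apply: eq_bigr => C Cr; apply: eq_bigr => C' /andP[Cr' CC].
by rewrite avg_mul // => A Acl; apply: idle => //; rewrite eq_sym.
Qed.

Lemma side_size C h : (size h <= m)%N -> side m C h = Some set0.
Proof. by case: h => //= A h; rewrite leqNgt => /negbTE; rewrite ltnS => ->. Qed.

(** The mean proportion of roots in stage [a], [s] steps after time [m], as the solution of its
    master equation: a root leaves with probability [rate a / ncl] and arrives from the previous
    stage with probability [1 / ncl]. *)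
Fixpoint stage_pr s a : R :=
  if s is s'.+1 then
    (1 - rate a / ncl (m + s')) * stage_pr s' a +
    (if a is a'.+1 then stage_pr s' a' else 0) / ncl (m + s')
  else (a == 0%N)%:R.

Lemma EV_sumr_stage a s : (a <= k.+1)%N -> (m + s <= n)%N ->
  EV (m + s) (sumr (stage_ind a)) = ncl m * stage_pr s a.
Proof.
elim: s a => [|s IH] a ak msn.
  rewrite addn0 in msn *; rewrite -[RHS](EV_cst m _ msn); apply: EV_eq => // h vh hm.
  rewrite /sumr /stage_pr; under eq_bigr => C _ do rewrite /stage_ind /at_stage side_size ?hm // cards0 min0n.
  by rewrite sumr_const card_roots ?hm // [0%N == a]eq_sym -[LHS]mulr_natl.
rewrite addnS /=; rewrite addnS in msn.
transitivity (EV (m + s) (fun h => (1 - rate a / ncl (m + s)) * sumr (stage_ind a) h +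
   (ncl (m + s))^-1 * sumr (prev_stage_ind a) h)).
  apply: EV_eq => [|h vh hs]; first exact: ltnW.
  rewrite avg_sumr ?hs ?leq_addr // /sumr !mulr_sumr -big_split.
  apply: eq_bigr => C Cr; rewrite avg_stage_ind ?hs ?leq_addr //.
  by rewrite [X in _ + X]mulrC.
rewrite EVD !EVZ IH ?(ltnW msn) // mulrDr mulrCA; congr (_ + _).
rewrite mulrC mulrA; congr (_ / _); case: a ak => [|a] ak.
  rewrite mulr0 -[RHS](EV_cst (m + s) _ (ltnW msn)); apply: EV_eq; first exact: ltnW.
  by move=> h _ _; rewrite /sumr big1.
by rewrite -IH ?(ltnW msn) ?(ltnW ak).
Qed.

(** Bounds every probability [rate a / ncl t] from time [m] on; it is of order [1 / m]. *)
Definition overlap : R := (k * k)%:R / ncl m.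

Hypothesis km : (k <= m)%N.

Lemma rate_le a : (a <= k.+1)%N -> rate a <= (k * k)%:R.
Proof.
move=> ak; rewrite /rate ler_nat /alpha; case: eqP => _; first by rewrite muln_gt0; lia.
by case: ifP => [ak'|_]; [rewrite leq_mul2r ak' orbT|rewrite leq_subr].
Qed.

Lemma ler_ncl s t : (s <= t)%N -> ncl s <= ncl t.
Proof. by move=> side'; rewrite ler_nat leq_add2l leq_mul2l side' orbT. Qed.

Lemma rate_ncl a t : (a <= k.+1)%N -> (m <= t)%N -> rate a / ncl t <= overlap.
Proof.
move=> ak mt; rewrite /overlap ler_pM ?rate_le ?ler0n ?invr_ge0 ?(ltW (ncl_gt0 _)) //.
by rewrite lef_pV2 ?posrE ?ncl_gt0 // ler_ncl.
Qed.

Lemma overlap_ge0 : 0 <= overlap.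
Proof. by rewrite divr_ge0 ?ler0n ?(ltW (ncl_gt0 _)). Qed.

Lemma overlap_le1 : overlap <= 1.
Proof. by rewrite ler_pdivrMr ?ncl_gt0 // mul1r ler_nat; nia. Qed.

Lemma stay_ge0 a s : (a <= k.+1)%N -> 0 <= 1 - rate a / ncl (m + s).
Proof.
by move=> ak; rewrite subr_ge0 (le_trans (rate_ncl a (m + s) ak _)) ?overlap_le1 ?leq_addr.
Qed.

Lemma stage_pr_ge0 s a : (a <= k.+1)%N -> 0 <= stage_pr s a.
Proof.
elim: s a => [|s IH] a ak /=; first exact: ler0n.
rewrite addr_ge0 ?mulr_ge0 ?IH ?stay_ge0 ?invr_ge0 ?(ltW (ncl_gt0 _)) //.
by case: a ak => // a ak; rewrite IH // ltnW.
Qed.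

Lemma pairr_ge0 g g' h : (forall C h, 0 <= g C h) -> (forall C h, 0 <= g' C h) ->
  0 <= pairr g g' h.
Proof. by move=> g0 g0'; apply: sumr_ge0 => C _; apply: sumr_ge0 => C' _; rewrite mulr_ge0. Qed.

Lemma EV_ge0 t F : (t <= n)%N -> (forall h, 0 <= F h) -> 0 <= EV t F.
Proof. by move=> tn F0; rewrite -[X in X <= _](EV_cst t 0 tn) EV_le. Qed.

Lemma stage_ind_idle C C' A h a b : valid h -> (size h < n)%N -> (m <= size h)%N ->
  C \in roots m h -> C' \in roots m h -> C != C' -> A \in cliques_of h ->
  stage_ind a C (A :: h) = stage_ind a C h \/ stage_ind b C' (A :: h) = stage_ind b C' h.
Proof.
move=> vh hn mh Cr Cr' CC Acl.
have vAh : valid (A :: h) by apply/and3P.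
by case: (idle_one m h C C' A m0 vAh mh Cr Cr' CC) => e; [left|right];
  rewrite /stage_ind /at_stage e.
Qed.

Lemma EV_pairr_step a b s : (a <= k.+1)%N -> (b <= k.+1)%N -> (m + s < n)%N ->
  EV (m + s).+1 (pairr (stage_ind a) (stage_ind b)) =
  (1 - rate a / ncl (m + s) - rate b / ncl (m + s)) * EV (m + s) (pairr (stage_ind a) (stage_ind b)) +
  (EV (m + s) (pairr (prev_stage_ind a) (stage_ind b)) + EV (m + s) (pairr (stage_ind a) (prev_stage_ind b)))
    / ncl (m + s).
Proof.
move=> ak bk msn; transitivity (EV (m + s) (fun h =>
  (1 - rate a / ncl (m + s) - rate b / ncl (m + s)) * pairr (stage_ind a) (stage_ind b) h +
  ((ncl (m + s))^-1 * pairr (prev_stage_ind a) (stage_ind b) h +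
   (ncl (m + s))^-1 * pairr (stage_ind a) (prev_stage_ind b) h))); last first.
  by rewrite !EVD !EVZ; ring.
rewrite /=; apply: EV_eq => [|h vh hs]; first exact: ltnW.
rewrite avg_pairr ?hs ?leq_addr //; last first.
  by move=> C C' A Cr Cr' CC Acl; apply: stage_ind_idle => //; rewrite hs ?leq_addr.
rewrite /pairr !mulr_sumr -!big_split /=; apply: eq_bigr => C Cr.
rewrite !mulr_sumr -!big_split /=; apply: eq_bigr => C' /andP[Cr' _].
rewrite !avg_stage_ind ?hs ?leq_addr //.
have n0 : ncl (m + s) != 0 by rewrite gt_eqF ?ncl_gt0.
by move: (ncl (m + s)) n0 => T n0; field.
Qed.

(* Two roots are independent up to a factor [(1 - overlap)^-1] per advance: the
   recursion for a pair lacks only the factor [1 - rate / ncl] of the idle root. *)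
Lemma EV_pairr_stage a b s : (a <= k.+1)%N -> (b <= k.+1)%N -> (m + s <= n)%N ->
  EV (m + s) (pairr (stage_ind a) (stage_ind b)) * (1 - overlap) ^+ (a + b) <=
  ncl m ^+ 2 * (stage_pr s a * stage_pr s b).
Proof.
have y0 : 0 <= 1 - overlap by rewrite subr_ge0 overlap_le1.
have y1 : 1 - overlap <= 1 by rewrite gerBl overlap_ge0.
elim: s a b => [|s IH] a b ak bk msn.
  rewrite addn0 in msn *.
  have e : EV m (pairr (stage_ind a) (stage_ind b)) <= ncl m ^+ 2 * (stage_pr 0 a * stage_pr 0 b).
    rewrite -[X in _ <= X](EV_cst m _ msn); apply: EV_le => // h vh hm.
    rewrite /pairr /=; apply: (@le_trans _ _
      (\sum_(C in roots m h) \sum_(C' in roots m h) (a == 0%N)%:R * (b == 0%N)%:R)).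
      apply: ler_sum => C _; rewrite [X in X <= _]big_mkcond [X in _ <= X]big_mkcond.
      apply: ler_sum => C' _; case: (C' \in _) => //=.
      rewrite /stage_ind /at_stage !side_size ?hm // cards0 min0n ![0%N == _]eq_sym.
      by case: ifP => // _; rewrite mulr_ge0 ?ler0n.
    rewrite !sumr_const card_roots ?hm // -!mulrnA -[X in X <= _]mulr_natl.
    by rewrite natrM -/(ncl m) -expr2.
  apply: le_trans e; rewrite ler_piMr ?exprn_ile1 //.
  by apply: EV_ge0 => // h; apply: pairr_ge0 => *; exact: ler0n.
rewrite addnS in msn *; rewrite EV_pairr_step //.
have msn' := ltnW msn.
set T := ncl (m + s); have T0 : 0 < T := ncl_gt0 _.
set y := 1 - overlap in y0 y1 *.
have ra := stay_ge0 a s ak; have rb := stay_ge0 b s bk.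
have ra' : y <= 1 - rate a / T by rewrite lerB // rate_ncl // leq_addr.
have rb' : y <= 1 - rate b / T by rewrite lerB // rate_ncl // leq_addr.
have pa := stage_pr_ge0 s a ak; have pb := stage_pr_ge0 s b bk.
set qa : R := if a is a'.+1 then stage_pr s a' else 0.
set qb : R := if b is b'.+1 then stage_pr s b' else 0.
have qa0 : 0 <= qa by rewrite /qa; case: (a) ak => // a' ak'; rewrite stage_pr_ge0 // ltnW.
have qb0 : 0 <= qb by rewrite /qb; case: (b) bk => // b' bk'; rewrite stage_pr_ge0 // ltnW.
(* An advance lowers [a + b] by one in the induction hypothesis, which leaves a spare factor [y]. *)
have i1 : EV (m + s) (pairr (prev_stage_ind a) (stage_ind b)) * y ^+ (a + b) <=
    ncl m ^+ 2 * (qa * stage_pr s b) * y.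
  rewrite /qa; case: (a) ak => [|a'] ak'.
    rewrite mul0r mulr0 mul0r -[X in _ <= X](mul0r (y ^+ (0 + b))) ler_wpM2r ?exprn_ge0 //.
    rewrite -[X in _ <= X](EV_cst (m + s) _ msn') EV_le // => h _ _.
    by rewrite /pairr big1 // => C _; rewrite big1 // => C' _; rewrite /prev_stage_ind /= mul0r.
  by rewrite addSn exprSr [X in X <= _]mulrA ler_wpM2r // IH // ltnW.
have i2 : EV (m + s) (pairr (stage_ind a) (prev_stage_ind b)) * y ^+ (a + b) <=
    ncl m ^+ 2 * (stage_pr s a * qb) * y.
  rewrite /qb; case: (b) bk => [|b'] bk'.
    rewrite !mulr0 mul0r -[X in _ <= X](mul0r (y ^+ (a + 0))) ler_wpM2r ?exprn_ge0 //.
    rewrite -[X in _ <= X](EV_cst (m + s) _ msn') EV_le // => h _ _.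
    by rewrite /pairr big1 // => C _; rewrite big1 // => C' _; rewrite /prev_stage_ind /= mulr0.
  by rewrite addnS exprSr [X in X <= _]mulrA ler_wpM2r // IH // ltnW.
have i0 := IH a b ak bk msn'.
have e0 : 0 <= EV (m + s) (pairr (stage_ind a) (stage_ind b)) * y ^+ (a + b).
  rewrite mulr_ge0 ?exprn_ge0 //; apply: EV_ge0 => // h.
  by apply: pairr_ge0 => *; exact: ler0n.
rewrite /= -/qa -/qb -/T in i0 i1 i2 e0 *.
move: i0 i1 i2 e0.
set e := EV _ _; set e1 := EV _ _; set e2 := EV _ _; set Y := y ^+ _; set K := ncl m ^+ 2.
move=> i0 i1 i2 e0.
have K0 : 0 <= K by rewrite exprn_ge0 // ltW ?ncl_gt0.
set u := 1 - rate a / T in ra ra' *; set w := 1 - rate b / T in rb rb' *.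
have -> : (u - rate b / T) = u + w - 1 by rewrite /w; ring.
have Ti : 0 <= T^-1 by rewrite invr_ge0 ltW.
(* A pair stays with probability [u + w - 1], which is at most [u * w]. In the advance terms the
   spare [y] replaces the factor [w] or [u] of the idle root. *)
have j0 : (u + w - 1) * (e * Y) <= u * w * (K * (stage_pr s a * stage_pr s b)).
  apply: (@le_trans _ _ (u * w * (e * Y))).
    rewrite ler_wpM2r // -subr_ge0.
    have -> : u * w - (u + w - 1) = (1 - u) * (1 - w) by ring.
    by rewrite mulr_ge0 // /u /w opprB addrC subrK divr_ge0 ?ler0n // ltW.
  by rewrite ler_wpM2l // mulr_ge0.
have j1 : e1 * Y <= K * (qa * stage_pr s b) * w.
  by apply: le_trans i1 _; rewrite ler_wpM2l // !mulr_ge0.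
have j2 : e2 * Y <= K * (stage_pr s a * qb) * u.
  by apply: le_trans i2 _; rewrite ler_wpM2l // !mulr_ge0.
have -> : ((u + w - 1) * e + (e1 + e2) / T) * Y =
  (u + w - 1) * (e * Y) + (e1 * Y + e2 * Y) / T by ring.
have -> : K * ((u * stage_pr s a + qa / T) * (w * stage_pr s b + qb / T)) =
  u * w * (K * (stage_pr s a * stage_pr s b)) + (K * (qa * stage_pr s b) * w + K * (stage_pr s a * qb) * u) / T
  + K * (qa / T * (qb / T)) by ring.
(* What remains on the right is the nonnegative term of simultaneous advances, which do not occur
   for a pair. *)
rewrite -[X in X <= _]addr0 lerD ?lerD ?ler_wpM2r ?lerD // !mulr_ge0 //.
Qed.

(** * Survival of completed cuts after time [m2] *)

Hypothesis m12 : (m <= m2)%N.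
Hypothesis km2 : (k < m2)%N.

Definition surv_ind C h : R := (alive m m2 C h)%:R.
Definition death_rate : R := (k * k - 1)%:R.

Lemma avg_surv_ind C h : valid h -> (size h < n)%N -> (m2 <= size h)%N -> C \in roots m h ->
  avg (surv_ind C) h = (1 - death_rate / ncl (size h)) * surv_ind C h.
Proof.
move=> vh hn mh Cr; have n0 : ncl (size h) != 0 by rewrite gt_eqF ?ncl_gt0.
rewrite avgE // /surv_ind sum_ind.
have /(congr1 (fun j => j%:R : R)) := alive_step m m2 C h m0 vh hn m12 mh Cr.
rewrite natrD ![in LHS]natrM [in RHS]natrM -/death_rate -/(ncl _) => e.
have -> : #|[set A in cliques_of h | alive m m2 C (A :: h)]|%:R =
   ncl (size h) * (alive m m2 C h)%:R - death_rate * (alive m m2 C h)%:R by lra.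
by move: (ncl (size h)) n0 => T n0; field.
Qed.

Lemma surv_ind_idle C C' A h : valid h -> (size h < n)%N -> (m2 <= size h)%N ->
  C \in roots m h -> C' \in roots m h -> C != C' -> A \in cliques_of h ->
  surv_ind C (A :: h) = surv_ind C h \/ surv_ind C' (A :: h) = surv_ind C' h.
Proof.
move=> vh hn mh Cr Cr' CC Acl.
have e D : side m D (A :: h) = side m D h -> surv_ind D (A :: h) = surv_ind D h.
  move=> eD; rewrite /surv_ind alive_cons // /at_stage eD -/(at_stage m k.+1 D h).
  by case: (boolP (alive m m2 D h)) => [/alive_ind ->|]; rewrite ?andbF.
have vAh : valid (A :: h) by apply/and3P.
by case: (idle_one m h C C' A m0 vAh (leq_trans m12 mh) Cr Cr' CC) => /e; [left|right].
Qed.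

Lemma death_rate_ncl s : 0 <= 1 - death_rate / ncl (m2 + s).
Proof.
rewrite subr_ge0 ler_pdivrMr ?ncl_gt0 // mul1r ler_nat.
have : (k * k <= k * (m2 + s))%N by rewrite leq_mul2l; apply/orP; right; lia.
by lia.
Qed.

Lemma EV_sumr_surv s : (m2 + s <= n)%N ->
  EV (m2 + s) (sumr surv_ind) = ncl m * stage_pr (m2 - m) k.+1 * \prod_(i < s) (1 - death_rate / ncl (m2 + i)).
Proof.
elim: s => [|s IH] msn.
  rewrite addn0 in msn *; rewrite big_ord0 mulr1 -EV_sumr_stage ?subnKC //.
  apply: EV_eq => // h vh hm; apply: eq_bigr => C _.
  by rewrite /surv_ind alive_size.
rewrite addnS in msn *; rewrite big_ord_recr /= mulrA -IH ?(ltnW msn) // mulrC -EVZ.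
apply: EV_eq => [|h vh hs]; first exact: ltnW.
have mh : (m2 <= size h)%N by rewrite hs leq_addr.
rewrite avg_sumr ?(leq_trans m12) // /sumr mulr_sumr; apply: eq_bigr => C Cr.
by rewrite avg_surv_ind // hs.
Qed.

(** Two roots never die in the same step, so a pair survives it with probability [1 - 2 * z], at
    most [(1 - z) ^+ 2]: no positive correlation is added after time [m2]. *)
Lemma EV_pairr_surv s : (m2 + s <= n)%N ->
  EV (m2 + s) (pairr surv_ind surv_ind) <=
  EV m2 (pairr (stage_ind k.+1) (stage_ind k.+1)) * (\prod_(i < s) (1 - death_rate / ncl (m2 + i))) ^+ 2.
Proof.
elim: s => [|s IH] msn.
  rewrite addn0 in msn *; rewrite big_ord0 expr1n mulr1; apply: EV_le => // h vh hm.
  apply: ler_sum => C _; apply: ler_sum => C' _.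
  by rewrite /surv_ind !alive_size.
rewrite addnS in msn *; rewrite big_ord_recr /= exprMn mulrA.
have IH' := IH (ltnW msn).
apply: (@le_trans _ _ (EV (m2 + s) (pairr surv_ind surv_ind) * (1 - death_rate / ncl (m2 + s)) ^+ 2)); last first.
  by rewrite ler_wpM2r // exprn_ge0 // death_rate_ncl.
rewrite mulrC -EVZ; apply: EV_le => [|h vh hs]; first exact: ltnW.
have mh : (m2 <= size h)%N by rewrite hs leq_addr.
have hn : (size h < n)%N by rewrite hs.
rewrite avg_pairr ?(leq_trans m12) //; last first.
  by move=> C C' A Cr Cr' CC Acl; apply: surv_ind_idle.
rewrite /pairr mulr_sumr; apply: ler_sum => C Cr.
rewrite mulr_sumr; apply: ler_sum => C' /andP[Cr' _].
rewrite !avg_surv_ind // hs; set z := death_rate / _.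
have e0 : 0 <= surv_ind C h * surv_ind C' h by rewrite mulr_ge0 ?ler0n.
rewrite -subr_ge0.
have -> : (1 - z) ^+ 2 * (surv_ind C h * surv_ind C' h) -
  (surv_ind C' h * ((1 - z) * surv_ind C h) + surv_ind C h * ((1 - z) * surv_ind C' h) - surv_ind C h * surv_ind C' h) =
  z ^+ 2 * (surv_ind C h * surv_ind C' h) by ring.
by rewrite mulr_ge0 // sqr_ge0.
Qed.

(** * Polya urns at the ends of the cut edges *)

(* With the shift by [k - 1] the expected change of [phi] in one step of the Polya
   urn [j -> j + (k - 1)] is exactly [- (k - 1) / ncl * phi j]. *)
Definition phi j : R := (j - (k - 1))%:R^-1.

(** Up to a factor [k] an upper bound for the cut rate, expressed through urn counts whose evolution
    is explicit. *)
Definition psi h U := \sum_(p in cross h U) (phi (Zin h U p.1) + phi (Zout h U p.2)).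
Definition psiC C h : R := if side m C h is Some U then psi h U else 0.

Lemma phi_ge0 j : 0 <= phi j.
Proof. by rewrite invr_ge0 ler0n. Qed.

Lemma phi_le1 j : (k <= j)%N -> phi j <= 1.
Proof. by move=> kj; rewrite /phi invf_le1 ?ltr0n ?ler1n; lia. Qed.

Lemma phi_le i j : (k <= i)%N -> (i <= j)%N -> phi j <= phi i.
Proof.
move=> ki ij; rewrite /phi lef_pV2 ?posrE ?ltr0n ?ler_nat; lia.
Qed.

Lemma psi_ge0 h U : 0 <= psi h U.
Proof. by apply: sumr_ge0 => p _; rewrite addr_ge0 ?phi_ge0. Qed.

Lemma psiC_ge0 C h : 0 <= psiC C h.
Proof. by rewrite /psiC; case: (side _ _ _) => // U; exact: psi_ge0. Qed.

(** The [j] choices in [T] contribute [1 / j] each, in total 1, and [1 + (#|S| - j) / (j - (k - 1))]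
    is the right-hand side. *)
Lemma sum_phi (S T : {set {set V}}) j : T \subset S -> #|T| = j -> (k <= j)%N ->
  \sum_(A in S) phi (j + (k - 1) * (A \in T)) = (#|S|%:R - (k - 1)%:R) * phi j.
Proof.
move=> TS cT kj.
rewrite (bigID (mem T)) /=.
rewrite (eq_bigr (fun=> phi (j + (k - 1)))) => [|A /andP[_ ->]]; last by rewrite muln1.
rewrite [X in _ + X](eq_bigr (fun=> phi j)) => [|A /andP[_ /negbTE ->]]; last first.
  by rewrite muln0 addn0.
rewrite !sumr_const.
have -> : #|[pred A | A \in S & A \in T]| = j.
  rewrite -cT; apply: eq_card => A; rewrite !inE andbC; apply/andb_idr.
  exact: (subsetP TS).
have -> : #|[pred A | A \in S & A \notin T]| = (#|S| - j)%N.
  rewrite -cT -[X in (X - _)%N](cardsID T) (setIidPr TS) addKn.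
  by apply: eq_card => A; rewrite !inE andbC.
have jS : (j <= #|S|)%N by rewrite -cT subset_leq_card.
rewrite -[X in X + _]mulr_natl -[X in _ + X]mulr_natl natrB // /phi addnK.
have j0 : (j%:R : R) != 0 by rewrite pnatr_eq0; lia.
have e : (j%:R : R) = (j - (k - 1))%:R + (k - 1)%:R by rewrite -natrD; congr _%:R; lia.
have j1 : ((j - (k - 1))%:R : R) != 0 by rewrite pnatr_eq0; lia.
rewrite mulfV //.
move: j1 e; set p := (j - (k - 1))%:R; set q := (k - 1)%:R => j1 ->.
by field.
Qed.

Lemma card_cross_lt C h U : inv m C h U -> (#|cross h U| <= k * k)%N.
Proof.
by move/inv_cross => /leq_trans; apply; rewrite leq_mul2l geq_minr orbT.
Qed.

(** A choice that the root survives lies inside [U] or is disjoint from it. It leaves the cut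
    unchanged and feeds the urns of one side only; as [phi] decreases, lower bounds on the counts
    suffice. *)
Lemma psi_step C h U A : valid h -> (size h < n)%N -> (m <= size h)%N -> C \in roots m h ->
  side m C h = Some U -> (k < #|U|)%N -> A \in cliques_of h -> ~~ mix U A ->
  psiC C (A :: h) <=
  \sum_(p in cross h U)
    (phi (Zin h U p.1 + (k - 1) * (A \in [set B in cliques_of h | (p.1 \in B) && (B \subset U)])) +
     phi (Zout h U p.2 + (k - 1) * (A \in [set B in cliques_of h | (p.2 \in B) && [disjoint B & U]]))).
Proof.
move=> vh hn mh Cr E kU Acl; rewrite /mix negb_and !negbK => mx.
have vAh : valid (A :: h) by apply/and3P.
have iU := side_inv m h C U m0 vh mh Cr E.
have [_ cC _] := rootsP m h C vh mh Cr.
rewrite /psiC side_cons // E /=.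
have -> : A == frontier C U = false.
  apply/eqP => eA; have := clique_card h A Acl; rewrite eA frontier_full // ?(ltnW kU) // => e.
  by rewrite e ltnn in kU.
have lt p : p \in cross h U -> [/\ p.1 \in U, p.2 \notin U & (p.2 < k + size h)%N].
  case: p => x y; rewrite crossE => /and3P[xy xU yU]; split => //=.
  by case/andP: (graph_of_lt h (x, y) vh xy).
rewrite /=; have [AU|AU] := boolP (A \subset U).
  rewrite /psi (cross_grow m h C U A) //; apply: ler_sum => p /lt[p1 p2 p2lt].
  have AD : [disjoint A & U] = false.
    by apply: contraNF (clique_neq0 h A Acl) => dj; rewrite (disjoint_sub0 A U dj AU).
  apply: lerD; apply: phi_le.
  - by rewrite (leq_trans (inv_in m C h U iU kU _ p1)) // leq_addr.
  - by rewrite in_set Acl AU andbT /=; exact: Zin_grow Cr iU _ AU p1.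
  - by rewrite (leq_trans (inv_out m C h U iU _ p2 p2lt)) // leq_addr.
  - by rewrite in_set AD !andbF muln0 addn0; exact: Zout_grow Cr iU _.
have AD : [disjoint A & U] by move: mx; rewrite (negbTE AU) orbF.
rewrite AD /psi (cross_stay m h C U A) //; apply: ler_sum => p /lt[p1 p2 p2lt].
apply: lerD; apply: phi_le.
- by rewrite (leq_trans (inv_in m C h U iU kU _ p1)) // leq_addr.
- by rewrite in_set (negbTE AU) !andbF muln0 addn0; exact: Zin_stay.
- by rewrite (leq_trans (inv_out m C h U iU _ p2 p2lt)) // leq_addr.
- by rewrite in_set Acl AD andbT /=; exact: Zout_stay Cr iU _ AD p2.
Qed.

(** Of all choices [death_rate] many kill the root, and averaging [phi] over the others costs a
    further [k - 1] by [sum_phi]; so the two rates add up. *)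
Lemma avg_psi C h : valid h -> (size h < n)%N -> (m2 <= size h)%N -> C \in roots m h ->
  avg (fun h => surv_ind C h * psiC C h) h <=
  (1 - (death_rate + (k - 1)%:R) / ncl (size h)) * (surv_ind C h * psiC C h).
Proof.
move=> vh hn m2h Cr; have mh := leq_trans m12 m2h.
have n0 : ncl (size h) != 0 by rewrite gt_eqF ?ncl_gt0.
rewrite avgE //; have [a1|a0] := boolP (alive m m2 C h); last first.
  rewrite big1 => [|A Acl]; first by rewrite /surv_ind (negbTE a0) mul0r !mulr0.
  by rewrite /surv_ind alive_cons // (negbTE a0) andbF mul0r.
have i1 := alive_ind _ _ _ _ a1.
case E : (side m C h) i1 => [U|]; rewrite /at_stage E // => /eqP Uk.
have kU : (k < #|U|)%N by rewrite -Uk geq_minl.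
have iU := side_inv m h C U m0 vh mh Cr E.
have [_ cC _] := rootsP m h C vh mh Cr.
set S := [set A in cliques_of h | ~~ mix U A].
have cS : (#|S|%:R : R) = ncl (size h) - death_rate.
  rewrite /ncl -card_cliques_of // -(card_splitC (mix U) (cliques_of h)) (inv_mix m C h U iU).
  by rewrite mixn_full ?(ltnW kU) // natrD -/death_rate addrAC subrr add0r.
have -> : \sum_(A in cliques_of h) surv_ind C (A :: h) * psiC C (A :: h) =
          \sum_(A in S) psiC C (A :: h).
  rewrite /S [RHS](eq_bigl (fun A => (A \in cliques_of h) && ~~ mix U A)); last by move=> A; rewrite inE.
  rewrite [RHS]big_mkcondr; apply: eq_bigr => A Acl.
  have vAh : valid (A :: h) by apply/and3P.
  rewrite /surv_ind alive_cons // a1 andbT (side_consE m C A h U mh vAh Cr iU E).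
  have UkE' : minn #|U|.+1 k.+1 = k.+1 by apply/minn_idPr; rewrite leqW.
  have -> : A == frontier C U = false.
    apply/eqP => eA; have := clique_card h A Acl; rewrite eA frontier_full // ?(ltnW kU) // => e.
    by rewrite e ltnn in kU.
  rewrite Uk UkE' eqxx andbT /= /mix negb_and !negbK.
  by case: (A \subset U); case: [disjoint A & U]; rewrite ?mul1r ?mul0r.
have -> : surv_ind C h = 1 by rewrite /surv_ind a1.
rewrite mul1r {2}/psiC E.
suff le : \sum_(A in S) psiC C (A :: h) <= (ncl (size h) - death_rate - (k - 1)%:R) * psi h U.
  apply: (@le_trans _ _ ((ncl (size h))^-1 * ((ncl (size h) - death_rate - (k - 1)%:R) * psi h U))).
    by rewrite ler_wpM2l // invr_ge0 ltW ?ncl_gt0.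
  rewrite le_eqVlt; apply/orP; left; apply/eqP.
  by move: (ncl (size h)) n0 => T n0; field.
apply: le_trans.
  apply: ler_sum => A.
  by rewrite /S inE => /andP[Acl mx]; exact: psi_step E kU Acl mx.
rewrite exchange_big /psi mulr_sumr /=; apply: ler_sum => -[x y].
rewrite crossE => /and3P[xy xU yU] /=.
have /andP[/= xlt ylt] := graph_of_lt h (x, y) vh xy.
rewrite big_split mulrDr -cS /= lerD // sum_phi //.
- apply/subsetP => B; rewrite !inE /mix => /and3P[-> _ ->].
  by rewrite andbF.
- exact: inv_in iU kU _ xU.
- apply/subsetP => B; rewrite !inE /mix => /and3P[-> _ ->].
  by [].
- exact: inv_out iU _ yU ylt.
Qed.

(** The constant is the bound at time [m2]: at most [k * k] cut edges, with two values of [phi] of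
    at most 1 each. *)
Lemma EV_psi s : (m2 + s <= n)%N ->
  EV (m2 + s) (sumr (fun C h => surv_ind C h * psiC C h)) <=
  (2 * (k * k))%:R * (ncl m * stage_pr (m2 - m) k.+1) *
    \prod_(i < s) (1 - (death_rate + (k - 1)%:R) / ncl (m2 + i)).
Proof.
elim: s => [|s IH] msn.
  rewrite addn0 in msn *; rewrite big_ord0 mulr1 -EV_sumr_stage ?subnKC // -EVZ.
  apply: EV_le => // h vh hm; rewrite mulr_sumr; apply: ler_sum => C Cr.
  have mh : (m <= size h)%N by rewrite hm.
  rewrite /surv_ind alive_size // -/(stage_ind k.+1 C h) mulrC /stage_ind.
  case i1 : (at_stage m k.+1 C h); last by rewrite !mulr0.
  rewrite ler_wpM2r // /psiC.
  move: i1; rewrite /at_stage; case E : (side m C h) => [U|] // /eqP Uk.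
  have kU : (k < #|U|)%N by rewrite -Uk geq_minl.
  have iU := side_inv m h C U m0 vh mh Cr E.
  apply: (@le_trans _ _ (\sum_(p in cross h U) 2)).
    apply: ler_sum => -[x y]; rewrite crossE => /and3P[xy xU yU] /=.
    have /andP[/= xlt ylt] := graph_of_lt h (x, y) vh xy.
    rewrite (_ : 2 = 1 + 1)//; apply: lerD; apply: phi_le1; first exact: inv_in iU kU _ xU.
    exact: inv_out iU _ yU ylt.
  rewrite sumr_const -[X in X <= _]mulr_natl natrM [X in X <= _]mulrC ler_wpM2l // ler_nat.
  exact: card_cross_lt iU.
rewrite addnS in msn *; rewrite big_ord_recr /= [X in _ <= X]mulrA.
set z := 1 - _ / ncl (m2 + s).
have z0 : 0 <= z.
  rewrite subr_ge0 ler_pdivrMr ?ncl_gt0 // mul1r -natrD ler_nat.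
  have : (k * k.+1 <= k * (m2 + s))%N by rewrite leq_mul2l; apply/orP; right; lia.
  by rewrite mulnS; lia.
apply: (@le_trans _ _ (EV (m2 + s) (sumr (fun C h => surv_ind C h * psiC C h)) * z)); last first.
  by rewrite ler_wpM2r // IH // ltnW.
rewrite mulrC -EVZ; apply: EV_le => [|h vh hs]; first exact: ltnW.
have m2h : (m2 <= size h)%N by rewrite hs leq_addr.
rewrite avg_sumr ?(leq_trans m12) // mulr_sumr; apply: ler_sum => C Cr.
by rewrite /z -hs; apply: avg_psi => //; rewrite hs.
Qed.

Lemma graph_of_sym h x y : ((x, y) \in graph_of h) = ((y, x) \in graph_of h).
Proof.
elim: h x y => [|A h IH] x y; rewrite /graph_of -/graph_of !inE /=.
  by rewrite andbCA [x == y]eq_sym.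
by rewrite -/(graph_of h) IH [X in _ || X]orbC.
Qed.

Lemma inv_deg_phi h x j : valid h -> (k <= j)%N -> (j <= #|[set B in cliques_of h | x \in B]|)%N ->
  (#|nbrs N (graph_of h) x|%:R)^-1 <= k%:R * phi j.
Proof.
move=> vh kj jB; have := leq_trans jB (leq_card_clique_deg h x vh).
set d := #|_| => jd.
have d0 : (0 < d)%N by case: (d) jd => //; rewrite muln0; lia.
apply: (@le_trans _ _ (k%:R / j%:R)).
  rewrite ler_pdivlMr ?ltr0n; last by lia.
  by rewrite mulrC ler_pdivrMr ?ltr0n // -natrM ler_nat.
rewrite ler_wpM2l ?ler0n // /phi lef_pV2 ?posrE ?ltr0n ?ler_nat; lia.
Qed.

Lemma cut_rate_psi C h U : valid h -> inv m C h U -> (k < #|U|)%N ->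
  cut_rate R N (graph_of h) U <= k%:R * psi h U.
Proof.
move=> vh iU kU; rewrite /cut_rate /psi mulr_sumr; apply: ler_sum => -[x y].
rewrite -/(cross h U) crossE => /and3P[xy xU yU] /=.
have /andP[/= xlt ylt] := graph_of_lt h (x, y) vh xy.
rewrite mulrDr lerD //; apply: inv_deg_phi => //.
- exact: inv_in iU kU _ xU.
- apply: subset_leq_card; apply/subsetP => B; rewrite !inE => /and3P[-> -> _] //.
- exact: inv_out iU _ yU ylt.
- apply: subset_leq_card; apply/subsetP => B; rewrite !inE => /and3P[-> -> _] //.
Qed.

Lemma pp_done_alive h C (s : V) r : valid h -> (m2 <= size h)%N -> C \in roots m h ->
  alive m m2 C h -> pp_done_prob R N (graph_of h) s r <= r%:R * (k%:R * psiC C h).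
Proof.
move=> vh m2h Cr /alive_ind; have mh := leq_trans m12 m2h.
rewrite /at_stage /psiC; case E : (side m C h) => [U|] // /eqP Uk.
have kU : (k < #|U|)%N by rewrite -Uk geq_minl.
have iU := side_inv m h C U m0 vh mh Cr E.
apply: le_trans (pp_done_cut R N (graph_of h) (graph_of_sym h) U s r _ _) _.
- by rewrite -card_gt0; lia.
(* The root lies outside [U], so the complement of [U] is not empty. *)
- have [Cc _ _] := rootsP m h C vh mh Cr.
  have := inv_disjoint_root m h C C U Cr vh mh iU; rewrite disjoints_subset.
  apply: contraTneq => ->; rewrite subset0; exact: clique_neq0 Cc.
by rewrite ler_wpM2l // (cut_rate_psi C).
Qed.

(** * From surviving cuts to the expected probability of completion *)

Definition surv : R := \prod_(i < n - m2) (1 - death_rate / ncl (m2 + i)).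
Definition mean_alive : R := ncl m * stage_pr (m2 - m) k.+1 * surv.

Lemma sumr_sq h : (sumr surv_ind h) ^+ 2 = sumr surv_ind h + pairr surv_ind surv_ind h.
Proof.
rewrite expr2 {1}/sumr mulr_suml -big_split /=; apply: eq_bigr => C Cr.
rewrite /sumr mulr_sumr (bigD1 C) //=; congr (_ + _).
by rewrite /surv_ind; case: (alive _ _ _ _); rewrite ?mulr1 ?mulr0.
Qed.

(** A bound graph by graph. If fewer than [mean_alive / 2] roots survive, the Chebyshev term is at
    least 1. Otherwise the bounds of [pp_done_alive] are averaged over at least that many
    survivors. *)
Lemma done_le h (s : V) r : 0 < mean_alive -> valid h -> (m2 <= size h)%N ->
  pp_done_prob R N (graph_of h) s r <=
  4 / mean_alive ^+ 2 * (sumr surv_ind h - mean_alive) ^+ 2 +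
  2 / mean_alive * (r%:R * k%:R) * sumr (fun C h => surv_ind C h * psiC C h) h.
Proof.
move=> mu0 vh m2h; set X := sumr surv_ind h; set D := pp_done_prob _ _ _ _ _.
set W := sumr _ h.
have W0 : 0 <= W by apply: sumr_ge0 => C _; rewrite mulr_ge0 ?ler0n ?psiC_ge0.
have n0 : mean_alive != 0 by rewrite gt_eqF.
have s1 : 0 <= 4 / mean_alive ^+ 2 * (X - mean_alive) ^+ 2.
  by rewrite mulr_ge0 ?divr_ge0 ?sqr_ge0.
have s2 : 0 <= 2 / mean_alive * (r%:R * k%:R) * W.
  by rewrite !mulr_ge0 ?invr_ge0 ?ler0n // ltW.
have [Xmu|Xmu] := ltP X (mean_alive / 2).
  apply: (@le_trans _ _ 1); first exact: pp_done_le1.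
  apply: (@le_trans _ _ (4 / mean_alive ^+ 2 * (X - mean_alive) ^+ 2)); last by rewrite lerDl.
  have : (mean_alive / 2) ^+ 2 <= (X - mean_alive) ^+ 2.
    rewrite -[(X - mean_alive) ^+ 2]sqrrN ler_pXn2r ?nnegrE //; lra.
  have e1 : 1 = 4 / mean_alive ^+ 2 * (mean_alive / 2) ^+ 2 by field.
  rewrite [X in _ -> X <= _]e1.
  by apply: ler_wpM2l; rewrite divr_ge0 ?sqr_ge0.
apply: (@le_trans _ _ (2 / mean_alive * (r%:R * k%:R) * W)); last by rewrite lerDr.
have XD : X * D <= r%:R * k%:R * W.
  rewrite mulr_suml mulr_sumr; apply: ler_sum => C Cr.
  rewrite mulrCA; have [a1|a0] := boolP (alive m m2 C h); last first.
    by rewrite /surv_ind (negbTE a0) !mul0r.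
  by rewrite ler_wpM2l ?ler0n // -mulrA; exact: pp_done_alive.
have D0 : 0 <= D by exact: pp_done_ge0.
rewrite -mulrA; apply: (@le_trans _ _ (2 / mean_alive * (X * D))).
  rewrite mulrA -[X in X <= _]mul1r ler_wpM2r // mulrAC ler_pdivlMr // mul1r; lra.
by rewrite ler_wpM2l // divr_ge0 // ltW.
Qed.

(** The Chebyshev term turns into a variance of at most [mean_alive + e * mean_alive ^+ 2], where
    [e] measures the correlation of pairs. In the other term survival cancels against [mean_alive],
    and only the decay of the urns is left. *)
Lemma done_EV (s : graph N -> V) r e : 0 < mean_alive -> 0 <= e -> (m2 <= n)%N ->
  1 <= (1 + e) * (1 - overlap) ^+ (k.+1 + k.+1) ->
  EV n (fun h => pp_done_prob R N (graph_of h) (s (graph_of h)) r) <=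
  4 / mean_alive + 4 * e +
  4 * (r%:R * k%:R ^+ 3) * \prod_(i < n - m2) (1 - (k - 1)%:R / ncl (m2 + i)).
Proof.
move=> mu0 e0 m2n xe.
have nE : n = (m2 + (n - m2))%N by rewrite subnKC.
set P := \prod_(i < _) _.
have mu1 : mean_alive != 0 by rewrite gt_eqF.
have EX : EV n (sumr surv_ind) = mean_alive.
  by rewrite {1}nE EV_sumr_surv ?subnKC.
have EP : EV n (pairr surv_ind surv_ind) <= (1 + e) * mean_alive ^+ 2.
  rewrite {1}nE; apply: le_trans (EV_pairr_surv _ _) _; first by rewrite subnKC.
  rewrite -/surv /mean_alive [X in _ <= _ * X]exprMn [X in _ <= X]mulrA ler_wpM2r ?sqr_ge0 //.
  have := EV_pairr_stage k.+1 k.+1 (m2 - m) (leqnn _) (leqnn _).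
  rewrite subnKC // => /(_ m2n); set Q := EV _ _ => hQ.
  have Q0 : 0 <= Q by apply: EV_ge0 => // h; apply: pairr_ge0 => *; exact: ler0n.
  apply: (@le_trans _ _ ((1 + e) * (Q * (1 - overlap) ^+ (k.+1 + k.+1)))).
    by rewrite mulrCA -[X in X <= _]mulr1 ler_wpM2l.
  rewrite ler_wpM2l ?addr_ge0 // (le_trans hQ) // exprMn -expr2.
  by [].
have EW : EV n (sumr (fun C h => surv_ind C h * psiC C h)) <= 2 * k%:R ^+ 2 * (mean_alive * P).
  rewrite {1}nE; apply: le_trans (EV_psi _ _) _; first by rewrite subnKC.
  rewrite natrM natrM -expr2 -!mulrA ler_wpM2l // ler_wpM2l ?ler0n // ler_wpM2l ?ler0n //.
  rewrite ler_wpM2l ?(ltW (ncl_gt0 _)) // ler_wpM2l ?stage_pr_ge0 //.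
  (* [1 - (a + b) <= (1 - a) * (1 - b)] separates survival from the decay of the urns. *)
  rewrite /surv /P -big_split /=; apply: ler_prod => i _; apply/andP; split.
    rewrite subr_ge0 ler_pdivrMr ?ncl_gt0 // mul1r -natrD ler_nat.
    have : (k * k.+1 <= k * (m2 + i))%N by rewrite leq_mul2l; apply/orP; right; lia.
    by rewrite mulnS; lia.
  set a := death_rate / _; rewrite mulrDl -/a; set b := (k - 1)%:R / _.
  have : 0 <= a * b by rewrite mulr_ge0 ?divr_ge0 ?ler0n ?(ltW (ncl_gt0 _)).
  by rewrite -subr_ge0 => ab; rewrite -subr_ge0; move: ab; congr (_ <= _); ring.
apply: (@le_trans _ _ (EV n (fun h => 4 / mean_alive ^+ 2 * (sumr surv_ind h - mean_alive) ^+ 2 +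
  2 / mean_alive * (r%:R * k%:R) * sumr (fun C h => surv_ind C h * psiC C h) h))).
  by apply: EV_le => // h vh hs; apply: done_le => //; rewrite hs.
rewrite EVD !EVZ.
have -> : EV n (fun h => (sumr surv_ind h - mean_alive) ^+ 2) = mean_alive + EV n (pairr surv_ind surv_ind) - mean_alive ^+ 2.
  transitivity (EV n (fun h => (sumr surv_ind h + pairr surv_ind surv_ind h) + ((-2 * mean_alive) * sumr surv_ind h + mean_alive ^+ 2))).
    by apply: EV_eq => // h _ _; rewrite -sumr_sq; ring.
  by rewrite !EVD EVZ EV_cst // EX; ring.
apply: lerD.
  apply: (@le_trans _ _ (4 / mean_alive ^+ 2 * (mean_alive + e * mean_alive ^+ 2))).
    by rewrite ler_wpM2l ?divr_ge0 ?sqr_ge0 // -addrA lerD2l lerBlDr addrC -[X in X + _]mul1r -mulrDl.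
  rewrite le_eqVlt; apply/orP; left; apply/eqP; by field.
apply: (@le_trans _ _ (2 / mean_alive * (r%:R * k%:R) * (2 * k%:R ^+ 2 * (mean_alive * P)))).
  by rewrite ler_wpM2l // !mulr_ge0 ?invr_ge0 ?ler0n // ltW.
rewrite le_eqVlt; apply/orP; left; apply/eqP; by field.
Qed.

(** The binomial coefficient selects the [a] steps at which the root advances, each with probability
    at least [1 / ncl m2]; the product accounts for not leaving a stage at the wrong time. The
    induction is Pascal's rule. *)
Lemma stage_pr_lower s a : (m + s <= m2)%N -> (a <= k.+1)%N ->
  \prod_(i < s) (1 - (k * k)%:R / ncl (m + i)) * ('C(s, a)%:R / ncl m2 ^+ a) <= stage_pr s a.
Proof.
elim: s a => [|s IH] a ms ak.
  by rewrite big_ord0 mul1r; case: a ak => [|a] ak; rewrite ?bin0n //= ?expr0 ?divr1 ?mul0r.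
have T0 := ncl_gt0 (m + s).
rewrite addnS in ms; rewrite big_ord_recr /=; set g := \prod_(i < s) _; set q := 1 - _.
have g0 : 0 <= g.
  apply: prodr_ge0 => i _; rewrite subr_ge0 ler_pdivrMr ?ncl_gt0 // mul1r ler_nat.
  have : (k * k <= k * (m + i))%N by rewrite leq_mul2l; apply/orP; right; lia.
  by lia.
have q0 : 0 <= q.
  rewrite subr_ge0 ler_pdivrMr ?ncl_gt0 // mul1r ler_nat.
  have : (k * k <= k * (m + s))%N by rewrite leq_mul2l; apply/orP; right; lia.
  by lia.
have q1 : q <= 1 by rewrite gerBl divr_ge0 ?ler0n ?ltW ?ncl_gt0.
have qr : q <= 1 - rate a / ncl (m + s).
  by rewrite lerD2l lerN2 ler_wpM2r ?rate_le // invr_ge0 ltW.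
have step1 : g * q * ('C(s, a)%:R / ncl m2 ^+ a) <= (1 - rate a / ncl (m + s)) * stage_pr s a.
  rewrite mulrAC mulrC ler_pM //; last exact: IH (ltnW ms) ak.
  by rewrite mulr_ge0 // divr_ge0 ?ler0n ?exprn_ge0 // ltW ?ncl_gt0.
case: a ak step1 {qr} => [|a] ak step1.
  by rewrite mul0r addr0; move: step1; rewrite !bin0.
rewrite binS natrD mulrDl mulrDr lerD // exprS invfM.
have -> : g * q * ('C(s, a)%:R * ((ncl m2)^-1 * (ncl m2 ^+ a)^-1)) =
   (g * ('C(s, a)%:R / ncl m2 ^+ a)) * (q / ncl m2) by ring.
apply: ler_pM.
- by rewrite mulr_ge0 // divr_ge0 ?ler0n ?exprn_ge0 // ltW ?ncl_gt0.
- by rewrite divr_ge0 // ltW ?ncl_gt0.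
- exact: IH (ltnW ms) (ltnW ak).
- apply: (@le_trans _ _ (ncl m2)^-1); first by rewrite ler_piMl // invr_ge0 ltW ?ncl_gt0.
  by rewrite lef_pV2 ?posrE ?ncl_gt0 // ler_ncl // (ltnW ms).
Qed.

End Expectation.

End KTreeHistory.

From mathcomp Require Import all_classical all_reals all_analysis.
Import numFieldNormedType.Exports.

(** * Asymptotics of the products *)

Section Asymptotics.
Local Open Scope ring_scope.
Variable R : realType.
Implicit Types (x y z p q : R).

Lemma le_powRl x y p : 0 <= p -> 0 <= x -> x <= y -> x `^ p <= y `^ p.
Proof.
move=> p0 x0 xy; apply: ge0_ler_powR => //; rewrite nnegrE //.
exact: le_trans xy.
Qed.

Lemma powR_inv x p : 0 <= x -> x^-1 `^ p = (x `^ p)^-1.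
Proof. by move=> x0; rewrite -powR_inv1 // powRAC powR_inv1 // powR_ge0. Qed.

(** Both sides are compared with [expR (- (p / y))], using [1 + x <= expR x] twice. *)
Lemma upper_factor p y : 0 <= p -> 0 < y -> 1 - p / y <= (y / (y + 1)) `^ p.
Proof.
move=> p0 y0; have y1 : 0 < y + 1 by lra.
have -> : y / (y + 1) = (1 + y^-1)^-1.
  have : y != 0 by rewrite gt_eqF.
  have : y + 1 != 0 by rewrite gt_eqF.
  by move=> a b; field; rewrite a b.
have i0 : 0 < y^-1 by rewrite invr_gt0.
rewrite powR_inv; last by lra.
have e0 := expR_gt0 (p / y).
apply: (@le_trans _ _ (expR (- (p / y)))); first exact: expR_ge1Dx.
rewrite expRN lef_pV2 ?posrE //; last by rewrite powR_gt0; lra.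
rewrite mulrC expRM; apply: le_powRl => //; first by lra.
exact: expR_ge1Dx.
Qed.

(** The intermediate value is [expR (- (q / (z + 1)))]; the shift by [q] turns the right-hand side
    into the inverse of [1 + q / (z + 1)]. *)
Lemma lower_factor q z : 0 <= q -> 0 < z -> (z / (z + 1)) `^ q <= 1 - q / (z + 1 + q).
Proof.
move=> q0 z0; have z1 : 0 < z + 1 by lra.
have -> : 1 - q / (z + 1 + q) = (1 + q / (z + 1))^-1.
  have : z + 1 + q != 0 by rewrite gt_eqF //; lra.
  have : z + 1 != 0 by rewrite gt_eqF.
  by move=> a b; field; rewrite a b.
have i0 : 0 <= q / (z + 1) by rewrite divr_ge0 // ltW.
have -> : z / (z + 1) = 1 + (- (z + 1)^-1).
  have : z + 1 != 0 by rewrite gt_eqF.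
  by move=> a; field.
apply: (@le_trans _ _ (expR (- (z + 1)^-1) `^ q)).
  apply: le_powRl => //; last exact: expR_ge1Dx.
  by rewrite subr_ge0 invf_le1 //; lra.
rewrite -expRM mulNr expRN lef_pV2 ?posrE ?expR_gt0 //; last by lra.
by rewrite [_^-1 * q]mulrC expR_ge1Dx.
Qed.

Lemma prod_telescope y L p : 0 < y ->
  \prod_(i < L) ((y + i%:R) / (y + i%:R + 1)) `^ p = (y / (y + L%:R)) `^ p.
Proof.
move=> y0; elim: L => [|L IH]; first by rewrite big_ord0 addr0 divff ?gt_eqF // powR1.
have yL : 0 < y + L%:R by rewrite ltr_pwDl.
have yL1 : 0 < y + L%:R + 1 by lra.
rewrite big_ord_recr /= IH -powRM ?divr_ge0 ?(ltW yL) ?(ltW y0) ?(ltW yL1) //.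
by rewrite -natr1 addrA; congr (_ `^ _); field; rewrite !gt_eqF.
Qed.

(** [1 + k * (t + i) <= k * (t + 1 + i)] reduces each factor to [upper_factor], and the powers
    telescope. *)
Lemma prod_upper k t L : (0 < k)%N -> (0 < t)%N ->
  \prod_(i < L) (1 - (k - 1)%:R / (1 + k * (t + i))%:R) <=
  ((t + 1)%:R / (t + 1 + L)%:R : R) `^ ((k - 1)%:R / k%:R).
Proof.
move=> k0 t0; rewrite [(t + 1 + L)%:R]natrD -prod_telescope ?ltr0n ?addn1 //.
apply: ler_prod => i _; apply/andP; split.
  by rewrite subr_ge0 ler_pdivrMr ?ltr0n // mul1r ler_nat; nia.
have k0' : (0 : R) < k%:R by rewrite ltr0n.
set y := _ + i%:R; have y0 : 0 < y by rewrite ltr_pwDl // ltr0n.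
apply: le_trans (upper_factor _ _ _ y0); last by rewrite divr_ge0.
rewrite lerD2l lerN2 -mulrA -invfM ler_wpM2l // lef_pV2 ?posrE ?mulr_gt0 ?ltr0n //.
by rewrite /y -natrD -natrM ler_nat; nia.
Qed.

(** The shift by [k.+1] absorbs the [1 + q] of [lower_factor], where [q = c / k] is at most [k]. *)
Lemma prod_lower k c t L : (0 < k)%N -> (c <= k * k)%N -> (k.+1 < t)%N ->
  ((t - k.+1)%:R / (t - k.+1 + L)%:R : R) `^ (c%:R / k%:R) <=
  \prod_(i < L) (1 - c%:R / (1 + k * (t + i))%:R).
Proof.
move=> k0 ck kt; rewrite [(t - k.+1 + L)%:R]natrD -prod_telescope ?ltr0n ?subn_gt0 //.
apply: ler_prod => i _; rewrite powR_ge0 /=.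
have k0' : (0 : R) < k%:R by rewrite ltr0n.
set z := _ + i%:R; have z0 : 0 < z by rewrite ltr_pwDl // ltr0n subn_gt0.
apply: le_trans (lower_factor _ _ _ z0) _; first by rewrite divr_ge0.
have c0 : (0 : R) <= c%:R by [].
rewrite lerD2l lerN2 -mulrA -invfM ler_wpM2l //.
rewrite lef_pV2 ?posrE ?ltr0n ?mulr_gt0 // ?ltr_pwDl ?addr_gt0 ?divr_ge0 ?(ltW k0') //.
2: by rewrite ltr0n subn_gt0.
rewrite mulrDr mulrCA mulfV ?gt_eqF // mulr1 /z -natrD natr1 -natrM -natrD ler_nat.
nia.
Qed.

Lemma bernoulli x M : 0 <= x <= 1 -> 1 - M%:R * x <= (1 - x) ^+ M.
Proof.
move=> /andP[x0 x1]; elim: M => [|M IH]; first by rewrite mul0r subr0 expr0.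
rewrite exprS; apply: (@le_trans _ _ ((1 - x) * (1 - M%:R * x))).
  rewrite -natr1 -subr_ge0.
  have -> : (1 - x) * (1 - M%:R * x) - (1 - (M%:R + 1) * x) = M%:R * (x * x) by ring.
  by rewrite !mulr_ge0.
by rewrite ler_wpM2l // subr_ge0.
Qed.

Lemma leq_ffact m j : ((m - j) ^ j <= m ^_ j)%N.
Proof.
elim: j m => [|j IH] [|m] //; first by rewrite sub0n exp0n.
rewrite ffactnS /= expnS subSS leq_mul //; first by rewrite leqW ?leq_subr.
Qed.

(** A lower bound, independent of [m], on the probability that a root is in the last stage at time
    [2 * m]: [4 ^ k] stems from the waiting steps, the rest from the [k.+1] advances. *)
Definition build_const k : R := (4 ^ k * ((6 * k) ^ k.+1 * k.+1`!))%:R^-1.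

Lemma build_const_gt0 k : (0 < k)%N -> 0 < build_const k.
Proof. by move=> k0; rewrite invr_gt0 ltr0n !muln_gt0 !expn_gt0 fact_gt0 muln_gt0 k0. Qed.

Lemma build_lower k m : (0 < k)%N -> (2 * k.+1 <= m)%N ->
  build_const k <= \prod_(i < m) (1 - (k * k)%:R / (1 + k * (m + i))%:R) *
                   ('C(m, k.+1)%:R / (1 + k * (m + m))%:R ^+ k.+1).
Proof.
move=> k0 km; set j := (m - k.+1)%N.
have j0 : (0 < j)%N by rewrite /j; lia.
(* Hence [j / (j + m)] is at least [1 / 4] and [1 + k * (m + m)] is at most [6 * k * j]. *)
have mj : (m <= 2 * j)%N by rewrite /j; lia.
rewrite /build_const natrM invfM; apply: ler_pM; rewrite ?invr_ge0 ?ler0n //.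
  apply: le_trans (prod_lower k (k * k) m m k0 (leqnn _) _); last by lia.
  rewrite natrM mulfK ?pnatr_eq0; last by lia.
  rewrite powR_mulrn ?divr_ge0 // natrX -exprVn; apply: lerXn2r; rewrite ?nnegrE ?invr_ge0 ?divr_ge0 //.
  rewrite ler_pdivlMr ?ltr0n ?addn_gt0 ?j0 //.
  by rewrite mulrC ler_pdivrMr ?ltr0n // -natrM ler_nat -/j; lia.
rewrite ler_pdivlMr ?exprn_gt0 ?ltr0n // mulrC ler_pdivrMr ?ltr0n ?muln_gt0 ?fact_gt0 ?expn_gt0 ?muln_gt0 ?k0 //.
rewrite -natrX -natrM ler_nat [X in (_ <= _ * X)%N]mulnC mulnA bin_ffact.
apply: (@leq_trans (j ^ k.+1 * (6 * k) ^ k.+1)%N).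
  rewrite -expnMn leq_exp2r //; nia.
by rewrite leq_mul2r leq_ffact orbT.
Qed.

Lemma powR_nat_large p T : 0 < p -> exists N0 : nat, forall n, (N0 <= n)%N -> T <= n%:R `^ p.
Proof.
move=> p0; set S := Num.max T 0; exists (Num.trunc (S `^ p^-1)).+1 => n Nn.
have S0 : 0 <= S by rewrite le_max lexx orbT.
apply: (@le_trans _ _ S); first by rewrite le_max lexx.
have e : S = (S `^ p^-1) `^ p by rewrite -powRrM mulVf ?gt_eqF // powRr1.
rewrite [X in X <= _]e; apply: le_powRl; rewrite ?powR_ge0 ?(ltW p0) //.
by apply: (le_trans (ltW (truncnS_gt _))); rewrite ler_nat.
Qed.

End Asymptotics.

(** * Choice of the parameters and the final bound *)

Local Open Scope classical_set_scope.
Local Open Scope ring_scope.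

(** [done_EV] for [m2 = m + m], with powers in place of products. The summands account for the
    fluctuation in the number of surviving roots, for the correlation of pairs and for crossings of
    the cuts. *)
Lemma done_prob_le (R : realType) (k n m : nat) (s : graph (n + k) -> 'I_(n + k))
    (r : nat) (e : R) :
  (1 < k)%N -> (2 * k.+1 <= m)%N -> (m + m <= n)%N -> 0 <= e ->
  1 <= (1 + e) * (1 - (k * k)%:R / (1 + k * m)%:R) ^+ (k.+1 + k.+1) ->
  ktree_pp_done_prob R k n s r <=
  4 / (build_const R k * (m%:R * (m%:R / n%:R) `^ ((k * k - 1)%:R / k%:R))) + 4 * e +
  4 * (r%:R * k%:R ^+ 3) * ((m + m + 1)%:R / (n + 1)%:R) `^ ((k - 1)%:R / k%:R).
Proof.
move=> k1 km mn e0 xe.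
have k0 : (0 < k)%N by lia.
have x0 : 'I_(n + k) by apply: (@Ordinal _ 0); lia.
have nkN := leqnn (n + k).
have m0 : (0 < m)%N by lia.
have m0R : 0 < m%:R :> R by rewrite ltr0n.
have n0R : 0 < n%:R :> R by rewrite ltr0n; lia.
have kmN : (k <= m)%N by lia.
have m12 : (m <= m + m)%N by lia.
have km2 : (k < m + m)%N by lia.
have q0 := build_const_gt0 R k k0.
set lo := _ * (m%:R * _).
have lo0 : 0 < lo by rewrite !mulr_gt0 // powR_gt0 // divr_gt0.
have mu_lo : lo <= mean_alive n k R m (m + m).
  (* The factors are the number of roots, the completion by time [2 * m] and the survival up to [n];
     the last one uses that [m + m - k.+1] is at least [m]. *)
  rewrite /lo mulrCA /mean_alive mulrA; apply: ler_pM.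
  - by rewrite mulr_ge0 // ltW.
  - exact: powR_ge0.
  - apply: ler_pM => //; [exact: ltW| |].
      by rewrite /ncl ler_nat; nia.
    apply: le_trans (build_lower R k m k0 km) _; rewrite addnK.
    exact: (stage_pr_lower (n + k) n k nkN k1 R m (m + m)).
  have kmm : (k.+1 < m + m)%N by lia.
  apply: le_trans (prod_lower R k (k * k - 1) (m + m) (n - (m + m)) k0 (leq_subr _ _) kmm).
  apply: le_powRl; rewrite ?divr_ge0 //.
  by rewrite ler_pdivrMr // mulrAC ler_pdivlMr ?ltr0n -?natrM ?ler_nat; [nia|lia].
have mu0 := lt_le_trans lo0 mu_lo.
rewrite /ktree_pp_done_prob /random_ktree_ev.
have := kt_ev_EV (n + k) n k nkN k1 R (fun E => pp_done_prob R (n + k) E (s E) r) n 0.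
rewrite addn0 => /(_ (leqnn n)) /= ->.
apply: le_trans (done_EV (n + k) n k x0 nkN k1 R m (m + m) m0 kmN m12 km2 s r e mu0 e0 mn xe) _.
apply: lerD.
  by rewrite lerD2r ler_wpM2l // lef_pV2 ?posrE.
rewrite ler_wpM2l ?mulr_ge0 ?exprn_ge0 //.
apply: le_trans (prod_upper R k (m + m) (n - (m + m)) k0 _) _; first by lia.
by have -> : (m + m + 1 + (n - (m + m)) = n + 1)%N by lia.
Qed.

Theorem theorem2 (R : realType) (k : nat) (f : nat -> R) :
  (2 <= k)%N ->
  (fun n : nat => f n / ln (ln (n%:R : R))) @ \oo --> (0 : R) ->
  f @ \oo --> +oo ->
  forall eps : R, 0 < eps ->
  exists N0 : nat, forall n : nat, (N0 <= n)%N ->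
    forall (s : graph (n + k) -> 'I_(n + k)) (r : nat),
      r%:R < powR (n%:R : R) ((k - 1)%:R / (k ^ 2 + k - 1)%:R) * (f n ^+ 2)^-1 ->
      ktree_pp_done_prob R k n s r < eps.
Proof.
move=> k1 _ f_oo eps eps0.
have k0 : (0 < k)%N by lia.
have q0 := build_const_gt0 R k k0; set q := build_const R k in q0.
have kR : 1 < k%:R :> R by rewrite ltr1n.
set A : R := (k ^ 2 + k - 1)%:R.
have AE : A = k%:R ^+ 2 + k%:R - 1.
  by rewrite /A natrB ?natrD ?natrX //; lia.
have kkE : (k * k - 1)%:R = k%:R ^+ 2 - 1 :> R.
  by rewrite natrB ?natrM ?expr2 // muln_gt0 k0.
have k1E : (k - 1)%:R = k%:R - 1 :> R by rewrite natrB.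
have A0 : 0 < A by rewrite AE; nra.
(* [m] will be of order [n] to the power [theta], which solves
   [theta = (1 - theta) * (k * k - 1) / k]: this balances the number of roots against their
   survival. The decay of the urns then has exponent [beta]. *)
set theta : R := (k * k - 1)%:R / A.
set beta := (k - 1)%:R / A.
have th0 : 0 < theta by rewrite divr_gt0 // kkE; nra.
have th1 : 0 < 1 - theta.
  have -> : 1 - theta = k%:R / A.
    by rewrite /theta kkE; move: A0 AE => /lt0r_neq0 An AE; field: AE.
  by rewrite divr_gt0 //; lra.
(* [K] brings the first summand of [done_prob_le] down to [eps / 8], and [e] below makes the second
   one [eps / 4]. *)
pose K := 1 + 32 / (q * eps).
have K1 : 1 <= K by rewrite /K lerDl divr_ge0 // mulr_ge0 // ltW.
pose e := eps / 16.
have e0 : 0 < e by rewrite divr_gt0.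
pose M := (k.+1 + k.+1)%N.
(* A lower bound for [m]: the first term keeps the correlation of pairs within [1 + e], the second
   leaves room for the [k.+1] advances. *)
pose T := M%:R * k%:R * (1 + e) / e + (2 * k.+1)%:R.
have [N1 HN1] := powR_nat_large R theta (Num.max T 1) th0.
(* This will give [4 * K * y <= n], hence [m + m <= n]. *)
have [N2 HN2] := powR_nat_large R (1 - theta) (4 * K) th1.
(* The third summand is at most [24 * k ^ 3 * K / f n ^ 2] and has to stay below [eps / 4], whence
   96. The added 1 ensures [f n <= f n ^+ 2]. *)
have [N3 _ HN3] : \forall n \near \oo, 1 + 96 * k%:R ^+ 3 * K / eps <= f n.
  by move/cvgryPge : f_oo; apply.
exists (maxn 1 (maxn N1 (maxn N2 N3))) => n.
rewrite !geq_max => /and4P[n1 /HN1 + /HN2 nth1 /HN3 /= fn] s r hr.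
rewrite ge_max => /andP[yT y1].
have n0R : 0 < n%:R :> R by rewrite ltr0n.
set y := _ `^ theta in yT y1.
(* Rounding up gives [K * y < m <= 2 * (K * y)]. *)
pose m := (Num.trunc (K * y)).+1.
have Ky0 : 0 <= K * y by rewrite mulr_ge0 //; lra.
have mK : K * y < m%:R by exact: truncnS_gt.
have Ky1 : 1 <= K * y by rewrite -[1]mulr1 ler_pM.
have mK2 : m%:R <= 2 * (K * y).
  rewrite /m -natr1; have : (Num.trunc (K * y))%:R <= K * y by rewrite truncn_le.
  by lra.
clearbody m.
have yn : y * n%:R `^ (1 - theta) = n%:R.
  rewrite /y -powRD; last by rewrite (gt_eqF n0R) implybT.
  by rewrite addrC subrK powRr1 // ltW.
have mn : (m + m <= n)%N.
  rewrite -(ler_nat R) natrD -yn.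
  have : y * (4 * K) <= y * n%:R `^ (1 - theta) by rewrite ler_wpM2l //; lra.
  by lra.
have ym : y <= m%:R.
  by apply: le_trans (ltW mK); rewrite ler_peMl //; lra.
have km : (2 * k.+1 <= m)%N.
  rewrite -(ler_nat R) (le_trans _ ym) // (le_trans _ yT) // /T lerDr.
  by rewrite !mulr_ge0 ?invr_ge0 ?(ltW e0) // addr_ge0 // ltW.
have m0 : 0 < m%:R :> R by rewrite ltr0n; apply: leq_trans km.
have xe : 1 <= (1 + e) * (1 - (k * k)%:R / (1 + k * m)%:R) ^+ M.
  set x := _ / _.
  have x0 : 0 <= x by rewrite divr_ge0.
  have kkm : (k * k <= 1 + k * m)%N by move: km; clear; nia.
  have x1 : x <= 1 by rewrite ler_pdivrMr ?ltr0n // mul1r ler_nat.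
  have xkm : x * m%:R <= k%:R.
    rewrite mulrAC ler_pdivrMr ?ltr0n // -!natrM ler_nat mulnDr mulnA; exact: leq_addl.
  have Mx : M%:R * x * (1 + e) <= e.
    rewrite -(ler_pM2r m0).
    have : M%:R * k%:R * (1 + e) / e <= m%:R.
      apply: le_trans ym; apply: le_trans yT; rewrite /T lerDl; exact: ler0n.
    rewrite ler_pdivrMr // [m%:R * e]mulrC; apply: le_trans.
    have -> : M%:R * x * (1 + e) * m%:R = M%:R * (x * m%:R) * (1 + e) by ring.
    by rewrite ler_wpM2r ?ler_wpM2l //; lra.
  apply: (@le_trans _ _ ((1 + e) * (1 - M%:R * x))); first by lra.
  by rewrite ler_wpM2l ?bernoulli ?x0 //; lra.
apply: le_lt_trans (done_prob_le R k n m s r e k1 km mn (ltW e0) xe) _.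
rewrite -/q.
have yn1 : y / n%:R = n%:R `^ (theta - 1).
  by rewrite powRB ?powRr1 ?(ltW n0R) // (gt_eqF n0R) implybT.
have b1 : K <= m%:R * (m%:R / n%:R) `^ ((k * k - 1)%:R / k%:R).
  have e1 : y * (y / n%:R) `^ ((k * k - 1)%:R / k%:R) = 1.
    rewrite yn1 -powRrM -powRD; last by rewrite (gt_eqF n0R) implybT.
    have -> : theta + (theta - 1) * ((k * k - 1)%:R / k%:R) = 0; last by rewrite powRr0.
    by rewrite /theta kkE AE; field; rewrite -AE !gt_eqF //; lra.
  rewrite -[X in X <= _]mulr1 -[X in _ * X <= _]e1 [X in X <= _]mulrA; apply: ler_pM; rewrite ?powR_ge0 ?(ltW mK) //.
  apply: le_powRl; rewrite ?divr_ge0 ?(ltW n0R) //; first by lra.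
  by rewrite ler_wpM2r // invr_ge0 ltW.
have t1 : 4 / (q * (m%:R * (m%:R / n%:R) `^ ((k * k - 1)%:R / k%:R))) <= eps / 8.
  rewrite ler_pdivrMr; last by rewrite mulr_gt0 //; lra.
  apply: (@le_trans _ _ (eps / 8 * (q * K))).
    rewrite /K; have -> : eps / 8 * (q * (1 + 32 / (q * eps))) = eps / 8 * q + 4.
      by field; rewrite !gt_eqF.
    by rewrite lerDr mulr_ge0 ?divr_ge0 // ltW.
  by rewrite ler_wpM2l ?divr_ge0 ?(ltW eps0) // ler_wpM2l // ltW.
have t3 : 4 * (r%:R * k%:R ^+ 3) * ((m + m + 1)%:R / (n + 1)%:R) `^ ((k - 1)%:R / k%:R) <= eps / 4.
  set a := _ / k%:R.
  have a0 : 0 <= a by rewrite divr_ge0.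
  have a1 : a <= 1 by rewrite ler_pdivrMr ?ltr0n // mul1r ler_nat leq_subr.
  (* [m + m + 1 <= 3 * m <= 6 * K * y], and [y / n] to the power [a] is [n] to the power [- beta].
     As [6 * K] is at least 1 and [a] at most 1, its power is bounded by [6 * K]. *)
  have p1 : ((m + m + 1)%:R / (n + 1)%:R) `^ a <= 6 * K * n%:R `^ (- beta).
    apply: (@le_trans _ _ ((6 * K * (y / n%:R)) `^ a)).
      apply: le_powRl => //.
      rewrite mulrA; apply: ler_pM; rewrite ?invr_ge0 //.
        have m1 : 1 <= m%:R :> R by rewrite ler1n -(ltr0n R).
        rewrite natrD natrD (le_trans _ (_ : 3 * m%:R <= _)) //; first by lra.
        by rewrite -[X in _ <= X]mulrA; lra.
      by rewrite lef_pV2 ?posrE ?ltr0n ?addn1 // ler_nat leqnSn.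
    rewrite powRM; [|lra|by rewrite divr_ge0 // ltW //; lra].
    rewrite yn1 -powRrM (_ : (theta - 1) * a = - beta); last first.
      by rewrite /a /beta /theta kkE k1E AE; field; rewrite -AE !gt_eqF //; lra.
    rewrite ler_wpM2r ?powR_ge0 //; apply: ler1_powR => //; lra.
  have f1 : 1 <= f n.
    apply: le_trans fn; rewrite lerDl divr_ge0 ?(ltW eps0) // !mulr_ge0 ?exprn_ge0 //; lra.
  have rb : r%:R * n%:R `^ (- beta) <= (f n ^+ 2)^-1.
    rewrite powRN ler_pdivrMr ?powR_gt0 // mulrC ltW //.
  apply: (@le_trans _ _ (24 * k%:R ^+ 3 * K * (r%:R * n%:R `^ (- beta)))).
    apply: (@le_trans _ _ (4 * (r%:R * k%:R ^+ 3) * (6 * K * n%:R `^ (- beta)))).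
      by rewrite ler_wpM2l // !mulr_ge0 ?exprn_ge0.
    by rewrite le_eqVlt; apply/orP; left; apply/eqP; ring.
  apply: (@le_trans _ _ (24 * k%:R ^+ 3 * K * (f n ^+ 2)^-1)).
    by rewrite ler_wpM2l // !mulr_ge0 ?exprn_ge0 //; lra.
  rewrite ler_pdivrMr ?exprn_gt0 //; last by lra.
  have f2 : f n <= f n ^+ 2 by rewrite expr2 ler_peMl //; lra.
  apply: (@le_trans _ _ (eps / 4 * (96 * k%:R ^+ 3 * K / eps))).
    by rewrite le_eqVlt; apply/orP; left; apply/eqP; field; rewrite gt_eqF.
  by rewrite ler_wpM2l ?divr_ge0 ?(ltW eps0) //; lra.
rewrite /e; lra.
Qed.
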